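(* Fix a positive integer $m$. Let $\mu\subset\lambda$ be two partitions of length at most $m$, let $\omega_\lambda,\omega_\mu$ be the corresponding $m$-Grassmannian permutations, and choose $n\ge 1$ such that $\omega_\lambda\in S_n$. For the skew permutation $\omega:=\omega_{\lambda/\mu}=\omega_\lambda\omega_\mu^{-1}$ in $S_n$, the double Grothendieck polynomial satisfies \[ \mathfrak{G}_\omega(X,Y)=\sum_U \beta^{|U|-|\lambda/\mu|}(xy)^U \] where the sum is over all set-valued $m$-bitableaux $U$ of shape $\lambda/\mu$.
   Context: **Permutations.** $S_n$ is the symmetric group, with product the composition of functions, generated by $s_i=(i,i+1)$, $1\le i\le n-1$; $S_\infty=\bigcup_n S_n$; $\ell$ is the length function; $\omega_i:=\omega(i)$. A product $uv$ is reduced if $\ell(uv)=\ell(u)+\ell(v)$. **Grothendieck polynomials.** Let $\beta$ be a formal variable. The idCoxeter algebra of $S_n$ is the free unital associative $\mathbb{Z}[\beta]$-algebra generated by $\pi_1,\ldots,\pi_{n-1}$ modulo $\pi_i^2=\beta\pi_i$; $\pi_i\pi_j=\pi_j\pi_i$ for $|i-j|\ge 2$; $\pi_i\pi_{i+1}\pi_i=\pi_{i+1}\pi_i\pi_{i+1}$. For $w\in S_n$ put $\pi_w=\pi_{a_1}\cdots\pi_{a_r}$ for any reduced word $a_1\cdots a_r$ of $w$; these form a $\mathbb{Z}[\beta]$-basis, and $\langle\alpha,w\rangle$ denotes the coefficient of $\pi_w$ in $\alpha$ (coefficients extended by commuting variables). Let $X=(x_1,x_2,\ldots)$, $Y=(y_1,y_2,\ldots)$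 be commuting variables, and for an indeterminate $t$ set $A_i(t)=(1+t\pi_{n-1})(1+t\pi_{n-2})\cdots(1+t\pi_i)$, $A'_i(t)=(1+t\pi_i)(1+t\pi_{i+1})\cdots(1+t\pi_{n-1})$. For $\omega\in S_n$, \[ \mathfrak{G}_\omega(X,Y)=\langle A'_{n-1}(y_{n-1})\cdots A'_1(y_1)A_1(x_1)\cdots A_{n-1}(x_{n-1}),\omega\rangle . \] **Partitions and Grassmannian/skew permutations.** Partitions are identified with their Young diagrams; $\mu\subset\lambda$ is containment of diagrams; $\lambda/\mu$ is the skew diagram $\lambda\smallsetminus\mu$ and $|\lambda/\mu|=\sum_i(\lambda_i-\mu_i)$. The length of a partition is its number of nonzero parts. $\omega\in S_\infty$ is $m$-Grassmannian if $\ell(\omega s_i)>\ell(\omega)$ for all $i\ne m$. These correspond bijectively to partitions $\lambda$ of length at most $m$ via $\lambda=(\omega_m-m,\ldots,\omega_1-1)$; write $\omega=\omega_\lambda$. For $\mu\subset\lambda$ the factorization $\omega_\lambda=\omega_{\lambda/\mu}\,\omega_\mu$ is reduced; elements of the form $\omega_{\lambda/\mu}$ are the skew permutations. **Set-valued bitableaux.** Let $\mathbf{P}$ be the ordered alphabet $(n-1)'<\cdots<1'<1<\cdots<n-1$. The symbols $(n-1)',\ldots,1'$ are marked, the rest unmarked. An element of a subset of $\mathbf{P}$ is called an entry. For nonempty subsets $A,B$ write $A\le B$ if $\max(A)\le\min(B)$. A set-valued $m$-bitableau $U$ of shape $\lambda/\mu$ is a filling of the boxes of $\lambda/\mu$ with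 finite nonempty subsets of $\mathbf{P}$ which is weakly increasing along each row and down each column (for this relation $\le$), such that (i) the marked entries are strictly increasing down each column and the unmarked entries are strictly increasing along each row (i.e. no marked symbol occurs in two boxes of the same column, and no unmarked symbol occurs in two boxes of the same row), and (ii) the entries in row $i$ lie in the interval $[(\mu_i+m+1-i)',\lambda_i+m-i]$ for each $i\in[1,m]$. $|U|$ is the total number of symbols of $\mathbf{P}$ appearing in $U$, counted with multiplicity, and $(xy)^U=\prod_i x_i^{n'_i}\prod_i y_i^{n_i}$, where $n'_i$ (resp. $n_i$) is the number of times $i'$ (resp. $i$) appears in $U$. *)

(* Defs.v *)
From HB Require Import structures.
From Stdlib Require Import ClassicalEpsilon.
From mathcomp Require Import all_boot all_order all_fingroup all_algebra.
From mathcomp Require Import finmap.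
From mathcomp.multinomials Require Import monalg.

Set Implicit Arguments.
Unset Strict Implicit.
Unset Printing Implicit Defensive.

Import GRing.Theory Num.Theory.

Local Open Scope nat_scope.
Local Open Scope ring_scope.

(* S_n is ['S_n], acting on {0, ..., n-1}; the 1-based point i is the ordinal
   of value i.-1.  The 1-based generator s_i (1 <= i <= n-1) is indexed by the
   ordinal of ['I_n.-1] of value i.-1. *)
Section Permutations.
Variable n : nat.
Implicit Types (w u v : 'S_n) (a : seq 'I_n.-1).

(* MathComp's product of permutations is [(s * t) x = t (s x)]; [pmul u v] is
   the composite u o v. *)
Definition pmul u v : 'S_n := (v * u)%g.

Fact simple_ltn (i : 'I_n.-1) : (i.+1 < n)%N.
Proof. by rewrite -ltn_predRL. Qed.

Definition simple (i : 'I_n.-1) : 'S_n :=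
  tperm (Ordinal (ltnW (simple_ltn i))) (Ordinal (simple_ltn i)).

Definition word_perm a : 'S_n := foldr (fun i w => pmul (simple i) w) 1%g a.

Definition has_word w : pred nat :=
  fun r => [exists t : r.-tuple 'I_n.-1, word_perm t == w].

Fact word_perm_cat a b : word_perm (a ++ b) = pmul (word_perm a) (word_perm b).
Proof.
elim: a => [|i a IH] /=; first by rewrite /pmul mulg1.
by rewrite IH /pmul mulgA.
Qed.

Fact word_perm_tperm (d : nat) (x y : 'I_n) :
  y = (x + d.+1)%N :> nat -> exists a, word_perm a = tperm x y.
Proof.
elim: d y => [|d IH] y yE.
  have lti : (x < n.-1)%N.
    by rewrite ltn_predRL; apply: leq_ltn_trans (ltn_ord y); rewrite yE addn1.
  exists [:: Ordinal lti]; rewrite /= /pmul mul1g /simple.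
  by congr tperm; apply: val_inj => //=; rewrite yE addn1.
have ltz : (x + d.+1 < n)%N.
  by apply: ltn_trans (ltn_ord y); rewrite yE ltn_add2l.
have [a aE] := IH (Ordinal ltz) erefl.
have lti : (x + d.+1 < n.-1)%N.
  by rewrite ltn_predRL; apply: leq_ltn_trans (ltn_ord y); rewrite yE ltn_add2l.
exists (Ordinal lti :: a ++ [:: Ordinal lti]).
rewrite /= word_perm_cat aE /= /pmul mul1g.
have -> : simple (Ordinal lti) = tperm (Ordinal ltz) y.
  by rewrite /simple; congr tperm; apply: val_inj => //=; rewrite yE -addnS.
set s := tperm (Ordinal ltz) y.
have -> : (s * tperm x (Ordinal ltz) * s = tperm x (Ordinal ltz) ^ s)%g.
  by rewrite conjgE tpermV mulgA.
rewrite tpermJ tpermL tpermD //; rewrite -val_eqE /=.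
  by rewrite -[X in _ != X]addn0 eqn_add2l.
by rewrite yE -[X in _ != X]addn0 eqn_add2l.
Qed.

Fact word_perm_surj w : exists a, word_perm a = w.
Proof.
have [ts -> _] := prod_tpermP w.
elim: ts => [|[x y] ts [a aE]]; first by exists [::]; rewrite big_nil.
rewrite big_cons /=.
have [b bE] : exists b, word_perm b = tperm x y.
  case: (ltngtP x y) => [lt|lt|eq].
  - apply: (@word_perm_tperm (y - x).-1).
    by rewrite prednK ?subn_gt0 // subnKC // ltnW.
  - rewrite tpermC; apply: (@word_perm_tperm (x - y).-1).
    by rewrite prednK ?subn_gt0 // subnKC // ltnW.
  - by exists [::]; rewrite (val_inj eq) tperm1.
by exists (a ++ b); rewrite word_perm_cat aE bE.
Qed.

Fact ex_has_word w : exists r, has_word w r.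
Proof.
have [a aE] := word_perm_surj w; exists (size a).
by apply/existsP; exists (in_tuple a); rewrite aE.
Qed.

Definition ell w : nat := ex_minn (ex_has_word w).

Definition reduced_for w : pred (seq 'I_n.-1) :=
  fun a => (word_perm a == w) && (size a == ell w).

Fact ex_reduced w : exists a, reduced_for w a.
Proof.
rewrite /reduced_for /ell; case: ex_minnP => r /existsP[t tw] _.
by exists t; rewrite tw size_tuple eqxx.
Qed.

Definition reduced_word w : seq 'I_n.-1 := xchoose (ex_reduced w).

(* One-line notation of w viewed in S_oo: [one_line w i] is w(i), 1-based,
   with w(i) = i for i > n. *)
Definition one_line w (i : nat) : nat :=
  if insub i.-1 is Some k then (w k).+1 else i.

(* For w in S_n and i >= n, l(w s_i) > l(w) holds in S_oo for free, so only
   the i <= n-1 are tested. *)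
Definition grassmannian (m : nat) w : Prop :=
  forall i : 'I_n.-1, i.+1 <> m -> (ell w < ell (pmul w (simple i)))%N.

End Permutations.

(* A partition is the sequence of its nonzero parts; [part la i] is the
   1-based la_i, equal to 0 beyond the length [size la]. *)
Definition is_partition (la : seq nat) : bool :=
  sorted geq la && (0%N \notin la).

Definition part (la : seq nat) (i : nat) : nat := nth 0%N la i.-1.

Definition included (mu la : seq nat) : Prop :=
  forall i, (part mu i <= part la i)%N.

(* w = w_la: w is m-Grassmannian and la_i = w(m+1-i) - (m+1-i) for
   1 <= i <= m. *)
Definition grassmannian_of (n m : nat) (la : seq nat) (w : 'S_n) : Prop :=
  grassmannian m w /\
  forall i, (1 <= i <= m)%N ->
    (part la i + (m.+1 - i) = one_line w (m.+1 - i))%N.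

(* The idCoxeter algebra is handled as the free algebra on pi_1, ..., pi_(n-1)
   together with congruence modulo the two-sided ideal of its relations.  The
   base ring R is any commutative ring with a distinguished element beta; for
   R = Z[beta][X, Y] this is the extension of scalars of the Z[beta]-algebra. *)
Section IdCoxeter.
Variables (n : nat) (R : comNzRingType) (beta : R).

Definition free_alg := {malg R[{fmonom 'I_n.-1}]}.
HB.instance Definition _ := GRing.Lalgebra.on free_alg.

Definition gen (i : 'I_n.-1) : free_alg := << fmu i >>.

Inductive relator : free_alg -> Prop :=
| relator_quadratic i : relator (gen i * gen i - beta *: gen i)
| relator_commute (i j : 'I_n.-1) :
    (i.+2 <= j)%N || (j.+2 <= i)%N -> relator (gen i * gen j - gen j * gen i)
| relator_braid (i j : 'I_n.-1) : j = i.+1 :> nat ->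
    relator (gen i * gen j * gen i - gen j * gen i * gen j).

Inductive ideal : free_alg -> Prop :=
| ideal_relator f : relator f -> ideal f
| ideal0 : ideal 0
| idealD f g : ideal f -> ideal g -> ideal (f + g)
| idealMl f g : ideal g -> ideal (f * g)
| idealMr f g : ideal f -> ideal (f * g).

Definition eq_idCoxeter (f g : free_alg) : Prop := ideal (f - g).

Definition pi_perm (w : 'S_n) : free_alg := \prod_(i <- reduced_word w) gen i.

Definition is_expansion (f : free_alg) (c : 'S_n -> R) : Prop :=
  eq_idCoxeter f (\sum_(w : 'S_n) c w *: pi_perm w).

(* As the pi_w form a basis, exactly one family satisfies [is_expansion f]. *)
Definition coef (f : free_alg) (w : 'S_n) : R :=
  epsilon (inhabits (fun _ : 'S_n => 0 : R)) (is_expansion f) w.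

(* In the next three definitions an ordinal i : 'I_n.-1 is the 1-based index
   i.+1; [enum 'I_n.-1] is increasing and products are taken left to right. *)
Definition A_ (i : 'I_n.-1) (t : R) : free_alg :=
  \prod_(j <- rev (enum 'I_n.-1) | (i <= j)%N) (1 + t *: gen j).

Definition A'_ (i : 'I_n.-1) (t : R) : free_alg :=
  \prod_(j <- enum 'I_n.-1 | (i <= j)%N) (1 + t *: gen j).

Definition grothendieck (x y : nat -> R) (w : 'S_n) : R :=
  coef ((\prod_(i <- rev (enum 'I_n.-1)) A'_ i (y i.+1)) *
        (\prod_(i <- enum 'I_n.-1) A_ i (x i.+1))) w.

End IdCoxeter.

Section Bitableaux.
Variables (n m : nat) (la mu : seq nat).

(* The alphabet P: [inl k] is the marked symbol (k+1)' and [inr k] the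
   unmarked symbol k+1, ordered by [key]. *)
Definition letter := ('I_n.-1 + 'I_n.-1)%type.

Definition marked (a : letter) : bool := if a is inl _ then true else false.

Definition key (a : letter) : int :=
  match a with
  | inl k => - (k.+1)%:Z
  | inr k => (k.+1)%:Z
  end.

(* The box in row i and column j (1-based) of the skew diagram la / mu is
   encoded by the pair of ordinals (i-1, j-1). *)
Definition in_skew (b : 'I_m * 'I_(part la 1)) : bool :=
  (part mu b.1.+1 < b.2.+1 <= part la b.1.+1)%N.

Definition box := {b : 'I_m * 'I_(part la 1) | in_skew b}.
HB.instance Definition _ := Finite.on box.

Definition box_row (b : box) : nat := (val b).1.+1.
Definition box_col (b : box) : nat := (val b).2.+1.

Definition skew_size : nat := (\sum_(1 <= i < m.+1) (part la i - part mu i))%N.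

(* For nonempty A and B: max A <= min B. *)
Definition set_le (A B : {set letter}) : bool :=
  [forall a in A, forall b in B, key a <= key b].

Definition filling := {ffun box -> {set letter}}.
HB.instance Definition _ := Finite.on filling.

Definition is_bitableau (U : filling) : bool :=
  [&& [forall b, U b != set0],
      [forall b, forall b', (box_row b == box_row b') && (box_col b < box_col b')%N ==>
         set_le (U b) (U b')],
      [forall b, forall b', (box_col b == box_col b') && (box_row b < box_row b')%N ==>
         set_le (U b) (U b')],
      [forall b, forall b', (box_col b == box_col b') && (box_row b < box_row b')%N ==>
         [forall a, marked a ==> ~~ ((a \in U b) && (a \in U b'))]],
      [forall b, forall b', (box_row b == box_row b') && (box_col b < box_col b')%N ==>
         [forall a, ~~ marked a ==> ~~ ((a \in U b) && (a \in U b'))]] &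
      [forall b, forall a in U b,
         - (part mu (box_row b) + m + 1 - box_row b)%:Z <= key a
           <= (part la (box_row b) + m - box_row b)%:Z]].

Definition total_size (U : filling) : nat := (\sum_(b : box) #|U b|)%N.

Definition mult (a : letter) (U : filling) : nat := #|[set b | a \in U b]|.

Definition monomial (R : comNzRingType) (x y : nat -> R) (U : filling) : R :=
  (\prod_(k < n.-1) x k.+1 ^+ mult (inl k) U) *
  (\prod_(k < n.-1) y k.+1 ^+ mult (inr k) U).

End Bitableaux.

(* Z[beta][X, Y] with X = (x_1, x_2, ...) and Y = (y_1, y_2, ...) infinite;
   the indeterminates of index 0 are unused. *)
Definition groth_ring := {malg {poly int}[{cmonom (nat + nat)%type}]}.
HB.instance Definition _ := GRing.ComNzRing.on groth_ring.

Definition beta : groth_ring := ('X : {poly int})%:MP.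
Definition X (i : nat) : groth_ring := << ucm (inl i : (nat + nat)%type) >>.
Definition Y (i : nat) : groth_ring := << ucm (inr i : (nat + nat)%type) >>.

(* Main.v *)
From Stdlib Require Import ClassicalEpsilon.
Require Import Defs.
From mathcomp Require Import all_boot all_order all_fingroup all_algebra.
From mathcomp Require Import finmap zify.
From mathcomp.multinomials Require Import monalg.

(** Call the first m positions of a permutation beads. Multiplying [u] on the left
    by the generator s_j moves a bead from value j to the free value j + 1, and this
    adds a box of content j (m plus the column minus the row) to the partition of
    [u]; such moves lead from [wmu] to the Grassmannian permutations of the
    partitions containing mu.

    Coefficients of skew permutations are computed by an action of the idCoxeter
    algebra on functions c on S_n. The generator pi_j turns c into the function
    which is beta * c u + c (s_j u) when [u] has a removable box of content j
    outside mu, and 0 otherwise ([delete]). This is the transpose of left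
    multiplication on the span of the skew permutations over mu, and the relations
    hold because both sides of the braid relation act by zero ([act_ideal]). Let f
    act on the indicator function of [wmu] and evaluate at [wla]: the result is the
    coefficient of pi_w in f for w = wla wmu^-1 ([coef_act]). Two facts carry this.
    On a reduced word no box is met twice, since otherwise a shorter word would
    give the same permutation; hence a basis element acts by 0 or 1
    ([wact_reduced]). And every f has an expansion in the pi_w, because every word
    can be brought to a normal form along the chain S_1 < S_2 < ... by braid moves
    and squares, and reduced words of one permutation have the same normal form
    ([monom_pi_perm]).

    The product that defines the Grothendieck polynomial is a product of factors
    1 + t_p pi_(k p), indexed by the pairs p of a letter and a content; call them
    times, the rightmost factor being the first time. Reading off the factors
    from the last time on, each time is either skipped, or put in the corner of
    its content, and this corner then either keeps earlier times, at the price of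
    beta, or loses its box. So the coefficient is the sum over all fillings of the
    skew shape by nonempty sets of times of the right content which increase along
    rows and down columns ([act_prod_placements]).

    In the order of the factors marked letters run through the contents upwards
    and unmarked letters downwards. Two equal letters in a row or a column are
    therefore in the order of their times exactly when they are marked and in a
    row, or unmarked and in a column: increasing fillings by times are the
    semistandard conditions on set-valued bitableaux. Finally a letter of index i
    runs only through the contents at least i, and on fillings satisfying these
    conditions that amounts to the flag bounds ([valid_bitableauE]). *)

Set Implicit Arguments.
Unset Strict Implicit.
Unset Printing Implicit Defensive.

Import Order.TTheory GRing.Theory Num.Theory.

Local Open Scope ring_scope.

(** * Simple transpositions *)
Section Simple.
Variable n : nat.
Implicit Types (i j k : 'I_n.-1) (u : 'S_n).

Definition lo i : 'I_n := Ordinal (ltnW (simple_ltn i)).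
Definition hi i : 'I_n := Ordinal (simple_ltn i).

Lemma simple_lo i : simple i (lo i) = hi i. Proof. exact: tpermL. Qed.
Lemma simple_hi i : simple i (hi i) = lo i. Proof. exact: tpermR. Qed.

Lemma simple_fix i (x : 'I_n) : x != i :> nat -> x != i.+1 :> nat ->
  simple i x = x.
Proof. by move=> h1 h2; rewrite tpermD // -val_eqE /= eq_sym. Qed.

Lemma simple_sq i : (simple i * simple i = 1)%g.
Proof. exact: tperm2. Qed.

Definition far i j := (i.+2 <= j)%N || (j.+2 <= i)%N.

Lemma far_sym i j : far i j = far j i.
Proof. by rewrite /far orbC. Qed.

Lemma far_lo i j : far i j -> simple i (lo j) = lo j.
Proof. by rewrite /far => h; apply: simple_fix => /=; lia. Qed.

Lemma far_hi i j : far i j -> simple i (hi j) = hi j.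
Proof. by rewrite /far => h; apply: simple_fix => /=; lia. Qed.

Lemma simple_comm i j : far i j -> (simple i * simple j = simple j * simple i)%g.
Proof.
move=> fij; apply: (mulgI (simple j)^-1%g); rewrite mulKg -conjgE.
by rewrite tpermJ -!/(lo i) -!/(hi i) far_lo ?far_hi // far_sym.
Qed.

Lemma simple_braid i j : j = i.+1 :> nat ->
  (simple i * simple j * simple i = simple j * simple i * simple j)%g.
Proof.
move=> ij; have E: hi i = lo j by apply: val_inj.
have hl : simple i (hi j) = hi j by apply: simple_fix => /=; lia.
have ll : simple j (lo i) = lo i by apply: simple_fix => /=; lia.
have -> : (simple i * simple j * simple i = simple j ^ simple i)%g.
  by rewrite conjgE tpermV mulgA.
have -> : (simple j * simple i * simple j = simple i ^ simple j)%g.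
  by rewrite conjgE tpermV mulgA.
rewrite /= !tpermJ -!/(lo _) -!/(hi _) hl ll E simple_lo -E simple_hi //.
Qed.

Lemma word_perm_cons i (a : seq 'I_n.-1) :
  word_perm (i :: a) = (word_perm a * simple i)%g.
Proof. by []. Qed.

End Simple.

(** * The action of the algebra on functions on the symmetric group *)
Section Action.
Variables (n m : nat) (R : comNzRingType) (beta : R) (q : 'S_n).
Implicit Types (i j k : 'I_n.-1) (u : 'S_n) (c : 'S_n -> R).

Definition pos u x : 'I_n := (u^-1)%g x.

(** Deleting a box at the end of a row is moving its bead back from j + 1 to j: no
    other bead may be in the way, nor may the bead pass its starting value. *)
Definition removable u j : bool :=
  [&& (pos u (hi j) < m)%N, (m <= pos u (lo j))%N & (q (pos u (hi j)) <= j)%N].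

Definition peel u j : 'S_n := pmul (simple j) u.

Lemma pos_peel u j x : pos (peel u j) x = pos u (simple j x).
Proof. by rewrite /pos /peel /pmul invMg tpermV permM. Qed.

Lemma peelK u j : peel (peel u j) j = u.
Proof. by rewrite /peel /pmul -mulgA simple_sq mulg1. Qed.

(** The transpose of left multiplication by pi_j on the quotient of the algebra by
    the span of the pi_w with w not skew over [q], seen on families of
    coefficients. *)
Definition delete j c u : R :=
  if removable u j then beta * c u + c (peel u j) else 0.

Lemma eq_delete j c c' : c =1 c' -> delete j c =1 delete j c'.
Proof. by move=> e u; rewrite /delete !e. Qed.

Lemma removable_peel u j : removable u j -> removable (peel u j) j = false.
Proof.
case/and3P=> h1 h2 _; rewrite /removable !pos_peel simple_lo simple_hi.
by apply/negbTE; rewrite ltnNge h2.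
Qed.

Lemma delete_quadratic j c u : delete j (delete j c) u = beta * delete j c u.
Proof.
rewrite /delete; case rj: (removable u j); last by rewrite mulr0.
by rewrite (removable_peel rj) addr0.
Qed.

Lemma removable_far i j u : far i j -> removable (peel u i) j = removable u j.
Proof. by move=> fij; rewrite /removable !pos_peel far_lo ?far_hi. Qed.

Lemma delete_comm i j c u : far i j ->
  delete i (delete j c) u = delete j (delete i c) u.
Proof.
move=> fij; have fji : far j i by rewrite far_sym.
rewrite /delete !removable_far //.
case: (removable u i); case: (removable u j) => //; last by rewrite mulr0 addr0.
  have -> : peel (peel u i) j = peel (peel u j) i.
    by rewrite /peel /pmul -!mulgA (simple_comm fij).
  by rewrite !mulrDr -!addrA; congr (_ + _); rewrite !addrA; congr (_ + _); rewrite addrC.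
by rewrite mulr0 addr0.
Qed.

(** Boxes of contents k, k + 1, k cannot be deleted in succession, because the box
    preceding the first one on its diagonal is still covered from below when the
    third one is due. Skew permutations avoid 321 for this reason. *)
Lemma delete_braid_low i j c u : j = i.+1 :> nat ->
  delete i (delete j (delete i c)) u = 0.
Proof.
move=> ij; have E: hi i = lo j by apply: val_inj.
rewrite {1}/delete; case ri: (removable u i) => //; case/and3P: (ri) => r1 r2 _.
have -> : delete j (delete i c) u = 0.
  by rewrite /delete /removable -E [(m <= _)%N]leqNgt r1 andbF.
rewrite mulr0 add0r /delete; case rj: (removable _ j) => //.
rewrite (removable_peel ri) mulr0 add0r.
suff -> : removable (peel (peel u i) j) i = false by [].
have ll : simple j (lo i) = lo i by apply: simple_fix => /=; lia.
by rewrite /removable !pos_peel ll simple_lo [(m <= _)%N]leqNgt r1 andbF.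
Qed.

(** As above, the box preceding the first one on its diagonal being covered from
    the right. *)
Lemma delete_braid_high i j c u : j = i.+1 :> nat ->
  delete j (delete i (delete j c)) u = 0.
Proof.
move=> ij; have E: hi i = lo j by apply: val_inj.
rewrite {1}/delete; case rj: (removable u j) => //; case/and3P: (rj) => r1 r2 _.
have -> : delete i (delete j c) u = 0.
  by rewrite /delete /removable E [(_ < m)%N]ltnNge r2.
rewrite mulr0 add0r /delete; case ri: (removable _ i) => //.
rewrite (removable_peel rj) mulr0 add0r.
suff -> : removable (peel (peel u j) i) j = false by [].
have hl : simple i (hi j) = hi j by apply: simple_fix => /=; lia.
by rewrite /removable !pos_peel hl simple_hi ltnNge r2.
Qed.

Definition wact (a : seq 'I_n.-1) c : 'S_n -> R := foldr delete c a.

Lemma eq_wact a c c' : c =1 c' -> wact a c =1 wact a c'.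
Proof. by move=> e; elim: a => //= i a IH; apply: eq_delete. Qed.

Lemma wact_sum (I : Type) (r : seq I) (x : I -> R) (d : I -> 'S_n -> R) a u :
  wact a (fun v => \sum_(i <- r) x i * d i v) u =
  \sum_(i <- r) x i * wact a (d i) u.
Proof.
elim: a u => //= i a IH u; rewrite /delete; case: (removable u i); last first.
  by rewrite big1 // => k _; rewrite mulr0.
rewrite !IH big_distrr -big_split /=; apply: eq_bigr => k _.
by rewrite mulrDr mulrCA.
Qed.

Local Notation falg := (free_alg n R).

Definition act (f : falg) c u : R := mmap idfun (fun w : {fmonom 'I_n.-1} => wact w c u) f.

Lemma eq_act (f : falg) c c' : c =1 c' -> act f c =1 act f c'.
Proof. by move=> e u; apply: eq_bigr => w _; rewrite (eq_wact _ e). Qed.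

Lemma actD (f g : falg) c u : act (f + g) c u = act f c u + act g c u.
Proof. exact: mmapD. Qed.

Lemma actB (f g : falg) c u : act (f - g) c u = act f c u - act g c u.
Proof. exact: mmapB. Qed.

Lemma act_sum (I : Type) (r : seq I) (F : I -> falg) c u :
  act (\sum_(i <- r) F i) c u = \sum_(i <- r) act (F i) c u.
Proof. exact: raddf_sum. Qed.

Lemma actU x w c u : act << x *g w >> c u = x * wact w c u.
Proof. exact: mmapU. Qed.

Lemma actM (f g : falg) c u : act (f * g) c u = act f (act g c) u.
Proof.
rewrite malgME act_sum; apply: eq_bigr => k _ /=.
rewrite act_sum wact_sum big_distrr; apply: eq_bigr => l _ /=.
by rewrite actU mulrA fmM /wact foldr_cat.
Qed.

Lemma act0 (f : falg) c : c =1 (fun=> 0) -> act f c =1 (fun=> 0).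
Proof.
move=> c0 u; apply: big1_seq => w _; rewrite (eq_wact _ c0) /=.
suff -> : wact w (fun=> 0) u = 0 by rewrite mulr0.
by elim: (w : seq _) u => //= i a IH v; rewrite /delete !IH mulr0 addr0 if_same.
Qed.

Lemma act1 c u : act 1 c u = c u.
Proof. by rewrite [act _ _ _]mmapU mul1r fm1. Qed.

Lemma actZ x (f : falg) c u : act (x *: f) c u = x * act f c u.
Proof. by rewrite -mul_malgC actM [act _ _ _]mmapU fm1. Qed.

Lemma act_gen i c u : act (gen R i) c u = delete i c u.
Proof. by rewrite actU mul1r fmU. Qed.

Lemma act_genM i (f : falg) c u : act (gen R i * f) c u = delete i (act f c) u.
Proof. by rewrite actM act_gen. Qed.

Lemma act_word a c u : act (\prod_(i <- a) gen R i) c u = wact a c u.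
Proof.
elim: a u => [|i a IH] u; first by rewrite big_nil act1.
by rewrite big_cons act_genM; apply: eq_delete.
Qed.

Lemma act_relator (f : falg) c u : relator beta f -> act f c u = 0.
Proof.
have gg i j v : act (gen R i * gen R j) c v = delete i (delete j c) v.
  by rewrite act_genM; apply: eq_delete => ?; rewrite act_gen.
have ggg i j k v : act (gen R i * gen R j * gen R k) c v =
    delete i (delete j (delete k c)) v.
  rewrite actM; transitivity (act (gen R i * gen R j) (delete k c) v).
    by apply: eq_act => w; rewrite act_gen.
  by rewrite act_genM; apply: eq_delete => w; rewrite act_gen.
case=> [i|i j fij|i j ij].
- by rewrite actB actZ gg act_gen delete_quadratic subrr.
- rewrite actB; apply/eqP; rewrite subr_eq0; apply/eqP.
  by apply: etrans (gg i j u) _; apply: etrans (delete_comm _ _ fij) (esym (gg j i u)).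
rewrite actB; apply/eqP; rewrite subr_eq0; apply/eqP.
apply: etrans (ggg i j i u) _; apply: etrans (delete_braid_low _ _ ij) _.
exact: etrans (esym (delete_braid_high _ _ ij)) (esym (ggg j i j u)).
Qed.

Lemma act_ideal (f : falg) c u : ideal beta f -> act f c u = 0.
Proof.
move=> fI; elim: fI c u => {f} [f fr||f g _ IHf _ IHg|f g _ IHg|f g _ IHf] c' u.
- exact: act_relator.
- exact: (mmap0 (f := idfun)).
- by rewrite actD IHf IHg addr0.
- by rewrite actM (act0 _ (IHg _)).
- by rewrite actM IHf.
Qed.

Lemma act_eq (f g : falg) c u :
  eq_idCoxeter beta f g -> act f c u = act g c u.
Proof. by move=> fg; apply/eqP; rewrite -subr_eq0 -actB act_ideal. Qed.

End Action.

(** * Words modulo the idCoxeter relations *)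
Section Words.
Variables (n : nat) (R : comNzRingType) (beta : R).
Local Notation falg := (free_alg n R).
Implicit Types (i j k : 'I_n.-1) (f g h : falg) (a b c : seq 'I_n.-1).

Local Notation equiv := (@eq_idCoxeter n R beta).

Lemma equiv_refl f : equiv f f.
Proof. by rewrite /eq_idCoxeter subrr; apply: ideal0. Qed.

Lemma idealZ x f : ideal beta f -> ideal beta (x *: f).
Proof. by move=> fI; rewrite -mul_malgC; apply: idealMl. Qed.

Lemma equiv_sym f g : equiv f g -> equiv g f.
Proof.
rewrite /eq_idCoxeter => fg.
by have := idealZ (-1) fg; rewrite scaleN1r opprB.
Qed.

Lemma equiv_trans g f h : equiv f g -> equiv g h -> equiv f h.
Proof.
rewrite /eq_idCoxeter => fg gh.
by have := idealD fg gh; rewrite addrA subrK.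
Qed.

Lemma equivZ x f g : equiv f g -> equiv (x *: f) (x *: g).
Proof. by rewrite /eq_idCoxeter => fg; rewrite -scalerBr; apply: idealZ. Qed.

Lemma equivD f g f' g' : equiv f g -> equiv f' g' -> equiv (f + f') (g + g').
Proof.
rewrite /eq_idCoxeter => fg fg'.
by rewrite opprD addrACA; apply: idealD.
Qed.

Lemma equivM f g h : equiv g h -> equiv (f * g) (f * h).
Proof. by rewrite /eq_idCoxeter => gh; rewrite -mulrBr; apply: idealMl. Qed.

Lemma equivMr f g h : equiv f g -> equiv (f * h) (g * h).
Proof. by rewrite /eq_idCoxeter => fg; rewrite -mulrBl; exact: Defs.idealMr. Qed.

Lemma malg_scalerAr x f g : f * (x *: g) = x *: (f * g).
Proof.
rewrite (malgMEw (fsubset_refl _) (msuppZ_le x g)) malgME scaler_sumr.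
apply: eq_bigr => k _; rewrite scaler_sumr; apply: eq_bigr => l _.
by apply/malgP => w; rewrite !(mcoeffZ, mcoeffU) mulrnAr mulrCA.
Qed.

Definition monom a : falg := \prod_(i <- a) gen R i.

Lemma monom_cat a b : monom (a ++ b) = monom a * monom b.
Proof. exact: big_cat. Qed.

Lemma monom_cons i a : monom (i :: a) = gen R i * monom a.
Proof. exact: big_cons. Qed.

(** Braid-equivalence, through the three invariants that the sequel depends on. *)
Record same a b : Prop := Same {
  same_size : size a = size b;
  same_perm : word_perm a = word_perm b;
  same_monom : equiv (monom a) (monom b) }.

Lemma same_refl a : same a a.
Proof. by split=> //; apply: equiv_refl. Qed.

Lemma same_sym a b : same a b -> same b a.
Proof. by case=> h1 h2 h3; split=> //; apply: equiv_sym. Qed.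

Lemma same_trans b a c : same a b -> same b c -> same a c.
Proof.
case=> h1 h2 h3 [h4 h5 h6]; split; rewrite ?h1 ?h2 //.
exact: equiv_trans h3 h6.
Qed.

Lemma same_cat x a b y : same a b -> same (x ++ a ++ y) (x ++ b ++ y).
Proof.
case=> h1 h2 h3; split; first by rewrite !size_cat h1.
  by rewrite !word_perm_cat h2.
by rewrite !monom_cat; apply/equivM/equivMr.
Qed.

Lemma same_consr k a b : same a b -> same (k :: a) (k :: b).
Proof. by move/(@same_cat [:: k] _ _ [::]); rewrite !cats0. Qed.

Lemma same_catl a b y : same a b -> same (a ++ y) (b ++ y).
Proof. exact: (@same_cat [::]). Qed.

Lemma same_catr x a b : same a b -> same (x ++ a) (x ++ b).
Proof. by move/(@same_cat x _ _ [::]); rewrite !cats0. Qed.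

Lemma same_far i j : far i j -> same [:: i; j] [:: j; i].
Proof.
move=> fij; split=> //.
  by rewrite !word_perm_cons /= !mul1g -(simple_comm fij).
rewrite !monom_cons /monom big_nil !mulr1.
exact: (ideal_relator (relator_commute beta fij)).
Qed.

Lemma same_braid i j : j = i.+1 :> nat -> same [:: i; j; i] [:: j; i; j].
Proof.
move=> ij; split=> //.
  by rewrite !word_perm_cons /= !mul1g (simple_braid ij).
rewrite !monom_cons /monom big_nil !mulr1 !mulrA.
exact: (ideal_relator (relator_braid beta ij)).
Qed.

Lemma same_far_word k a : (forall j, j \in a -> far k j) ->
  same (k :: a) (rcons a k).
Proof.
elim: a => [|j a IH] ha; first exact: same_refl.
have kj : far k j by apply: ha; rewrite mem_head.
apply: same_trans (same_catl a (same_far kj)) _.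
by apply: same_consr; apply: IH => l la; apply: ha; rewrite in_cons la orbT.
Qed.

(** True of every word which braid moves bring to a word containing a square. The
    first clause lets monomials be simplified, and the second one says that no
    reduced word is of this kind; the two shorter words differ in general, since
    the square is replaced by a letter in one case and erased in the other. *)
Definition shrinks a : Prop :=
  (exists2 b, (size b < size a)%N & equiv (monom a) (beta *: monom b)) /\
  (exists2 c, (size c < size a)%N & word_perm c = word_perm a).

Lemma shrinks_same a b : same a b -> shrinks b -> shrinks a.
Proof.
case=> h1 h2 h3 [[b' s1 e1] [c s2 e2]]; split.
  by exists b'; rewrite ?h1 //; apply: equiv_trans e1.
by exists c; rewrite ?h1 ?h2.
Qed.

Lemma shrinks_catr x a : shrinks a -> shrinks (x ++ a).
Proof.
case=> [[b s1 e1] [c s2 e2]]; split.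
  exists (x ++ b); first by rewrite !size_cat ltn_add2l.
  rewrite !monom_cat; apply: equiv_trans (equivM _ e1) _.
  by rewrite malg_scalerAr; apply: equiv_refl.
by exists (x ++ c); rewrite ?size_cat ?ltn_add2l // !word_perm_cat e2.
Qed.

Lemma shrinks_sq k a : shrinks (k :: k :: a).
Proof.
split; last by exists a; [rewrite /= ltnS leqnSn | rewrite !word_perm_cons -mulgA simple_sq mulg1].
exists (k :: a) => //; rewrite !monom_cons mulrA scalerAl.
by apply: equivMr; apply: (ideal_relator (relator_quadratic beta k)).
Qed.

Definition run r0 p : seq 'I_n.-1 := pmap insub (iota r0 (p - r0)).

Lemma mem_run r0 p j : (j \in run r0 p) = (r0 <= j < p)%N.
Proof. by rewrite mem_pmap_sub mem_iota /=; lia. Qed.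

Lemma run_cons i p : (i < p)%N -> run i p = i :: run i.+1 p.
Proof.
move=> ip; rewrite /run -(subnSK ip) /=.
by case: insubP => [k _ ki|]; [congr (_ :: _); apply: val_inj | rewrite ltn_ord].
Qed.

Lemma run_cat r1 r0 p : (r0 <= r1 <= p)%N -> run r0 p = run r0 r1 ++ run r1 p.
Proof.
move=> h; rewrite /run -pmap_cat -[in iota r1 _](_ : r0 + (r1 - r0) = r1)%N; last lia.
by rewrite -iotaD; congr (pmap _ (iota _ _)); lia.
Qed.

Lemma run_nil p : run p p = [::].
Proof. by rewrite /run subnn. Qed.

(** Words of the form run i_p p ++ ... ++ run i_1 1: the coset decomposition of
    the symmetric group on p+1 letters along S_1 < S_2 < ... *)
Fixpoint normal p : seq 'I_n.-1 -> Prop :=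
  if p is p'.+1 then fun a => exists r0 b,
    [/\ (r0 <= p'.+1)%N, normal p' b & a = run r0 p'.+1 ++ b]
  else fun a => a = [::].

Lemma normal_nil p : normal p [::].
Proof.
elim: p => //= p IH; exists p.+1, [::]; split=> //.
by rewrite run_nil.
Qed.

Lemma same_run_far k r0 p : (forall j, (r0 <= j < p)%N -> far k j) ->
  same (k :: run r0 p) (run r0 p ++ [:: k]).
Proof.
move=> h; rewrite cats1; apply: same_far_word => j.
by rewrite mem_run; apply: h.
Qed.

(** The letter k commutes with the letters up to k - 2, then the factor k, k - 1, k
    becomes k - 1, k, k - 1, and the last k - 1 commutes with the letters from
    k + 1 on. *)
Lemma same_run_in j k r0 p : k = j.+1 :> nat -> (r0 < k < p)%N ->
  same (k :: run r0 p) (run r0 p ++ [:: j]).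
Proof.
move=> kj h; rewrite (@run_cat j); last lia.
rewrite (@run_cons j); last lia.
have -> : run j.+1 p = k :: run k.+1 p by rewrite -kj run_cons //; lia.
apply: same_trans (same_catl _ (same_run_far (p := j) _)) _.
  by move=> l hl; rewrite /far; lia.
rewrite -!catA /=; apply: same_catr.
apply: same_trans (same_catl (run k.+1 p) (same_sym (same_braid kj))) _.
rewrite /=; do 2!apply: same_consr; apply: same_run_far => l.
by rewrite /far; lia.
Qed.

(** The new letter extends the first run downwards, squares its first letter, or
    passes through the run to a normal word of the previous level. *)
Lemma normal_cons p a k : (k < p)%N -> normal p a ->
  shrinks (k :: a) \/ exists2 b, normal p b & same (k :: a) b.
Proof.
elim: p k a => // p IH k _ kp [r0 [b [r0p nb ->]]].
have push j : (j < p)%N -> same (k :: run r0 p.+1) (run r0 p.+1 ++ [:: j]) ->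
    shrinks (k :: run r0 p.+1 ++ b) \/
    exists2 b', normal p.+1 b' & same (k :: run r0 p.+1 ++ b) b'.
  move=> jp sj.
  have s1 : same (k :: run r0 p.+1 ++ b) (run r0 p.+1 ++ (j :: b)).
    by rewrite -cat_cons -(cat1s j) catA; apply: same_catl.
  case: (IH j b jp nb) => [sh|[b' nb' sb']]; [left|right].
    exact: shrinks_same s1 (shrinks_catr _ sh).
  exists (run r0 p.+1 ++ b'); first by exists r0, b'.
  exact: same_trans s1 (same_catr _ sb').
case: (ltngtP k r0) => ki.
- case: (ltngtP k.+1 r0) => ki1; last 1 first.
  + right; exists (k :: run r0 p.+1 ++ b); last exact: same_refl.
    exists k, b; split=> //; first by lia.
    by rewrite -cat_cons -ki1 -run_cons.
  + by apply: (push k); [lia | apply: same_run_far => j; rewrite /far; lia].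
  + by lia.
- have jn : (k.-1 < n.-1)%N by apply: leq_ltn_trans (ltn_ord k); lia.
  by apply: (push (Ordinal jn)) => /=; [lia | apply: same_run_in => /=; lia].
left; rewrite -ki run_cons //; exact: shrinks_sq.
Qed.

Lemma normal_or_shrinks a : shrinks a \/ exists2 b, normal n.-1 b & same a b.
Proof.
elim: a => [|k a [sh|[b nb sb]]].
- by right; exists [::]; [apply: normal_nil | apply: same_refl].
- by left; apply: (shrinks_catr [:: k]).
case: (normal_cons (ltn_ord k) nb) => [sh|[c nc sc]]; [left|right].
  exact: shrinks_same (same_consr k sb) sh.
by exists c => //; apply: same_trans (same_consr k sb) sc.
Qed.

Lemma word_perm_fix a (x : 'I_n) : (forall j, j \in a -> j.+1 < x)%N ->
  word_perm a x = x.
Proof.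
elim: a => [|j a IH] h; first by rewrite perm1.
rewrite word_perm_cons permM IH; last by move=> l la; apply: h; rewrite in_cons la orbT.
by have := h j (mem_head _ _) => jx; apply: simple_fix; lia.
Qed.

Lemma normal_mem p a j : normal p a -> j \in a -> (j < p)%N.
Proof.
elim: p a => [|p IH] a /=; first by move=> ->.
case=> r0 [b [_ nb ->]]; rewrite mem_cat mem_run => /orP[|/(IH _ nb)]; lia.
Qed.

(** This value recovers the first run of a normal word from its permutation. *)
Lemma word_perm_run r0 p (x : 'I_n) : (r0 <= p)%N -> x = p :> nat ->
  word_perm (run r0 p) x = r0 :> nat.
Proof.
move=> ip xp; have [d pE] : exists d, p = (r0 + d)%N by exists (p - r0)%N; lia.
elim: d r0 ip pE => [|d IH] r0 ip pE.
  by rewrite pE addn0 run_nil perm1; lia.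
have lti : (r0 < n.-1)%N by have := ltn_ord x; lia.
rewrite (@run_cons (Ordinal lti)); last by rewrite /=; lia.
rewrite word_perm_cons permM.
have -> : word_perm (run r0.+1 p) x = hi (Ordinal lti).
  by apply: val_inj; rewrite /= IH; lia.
by rewrite simple_hi.
Qed.

Lemma normal_inj p a b : (p <= n.-1)%N -> normal p a -> normal p b ->
  word_perm a = word_perm b -> a = b.
Proof.
elim: p a b => [|p IH] a b pn; first by move=> /= -> ->.
case=> i [a' [ip na ->]] [i' [b' [ip' nb ->]]] /= e.
have ltp : (p.+1 < n)%N by lia.
have val_at c r0 : normal p c -> (r0 <= p.+1)%N ->
    word_perm (run r0 p.+1 ++ c) (Ordinal ltp) = r0 :> nat.
  move=> nc r0p; rewrite word_perm_cat /pmul permM (@word_perm_fix c); last first.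
    by move=> j /(normal_mem nc) /=; lia.
  exact: word_perm_run.
have ii : i = i' by rewrite -(val_at a' i) // -(val_at b' i') // e.
rewrite -ii; congr (_ ++ _); apply: IH => //; first lia.
by move: e; rewrite !word_perm_cat /pmul -ii => /mulIg.
Qed.

Lemma reduced_wordP (w : 'S_n) :
  word_perm (reduced_word w) = w /\ size (reduced_word w) = ell w.
Proof. by have := xchooseP (ex_reduced w) => /andP[/eqP ? /eqP ?]. Qed.

Lemma ell_min (w : 'S_n) a : word_perm a = w -> (ell w <= size a)%N.
Proof.
move=> aw; rewrite /ell; case: ex_minnP => r _; apply.
by apply/existsP; exists (in_tuple a); rewrite aw.
Qed.

(** The reduced word chosen for w does not shrink, so it is braid-equivalent to a
    normal word, and there is only one normal word of permutation w. *)
Lemma pi_perm_normal (w : 'S_n) a : normal n.-1 a -> word_perm a = w ->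
  equiv (monom a) (pi_perm R w).
Proof.
move=> na aw; have [rw rs] := reduced_wordP w.
case: (normal_or_shrinks (reduced_word w)) => [[_ [c sc cw]]|[b nb [_ pb mb]]].
  by move: sc; rewrite rs ltnNge ell_min // cw.
rewrite (normal_inj (leqnn _) na nb); last by rewrite -pb aw rw.
exact: equiv_sym.
Qed.

(** The consequence of Matsumoto's theorem that makes the pi_w span the algebra:
    braid moves and squares reduce any word to a normal one. *)
Lemma monom_pi_perm a : exists (d : nat) w, equiv (monom a) (beta ^+ d *: pi_perm R w).
Proof.
have [s] := ubnP (size a); elim: s a => // s IH a lts.
case: (normal_or_shrinks a) => [[[b sb eb] _]|[b nb [_ _ ab]]]; last first.
  exists 0%N, (word_perm b); rewrite expr0 scale1r.
  exact: equiv_trans ab (pi_perm_normal nb _).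
have [|k [w e]] := IH b; first by lia.
exists k.+1, w; apply: equiv_trans eb _.
by rewrite exprS -scalerA; apply: equivZ.
Qed.

Lemma expansion_exists f : exists x : 'S_n -> R, is_expansion beta f x.
Proof.
rewrite (monalgE f).
elim: (enum_fset (msupp f)) => [|w r [x ex]].
  exists (fun=> 0); rewrite big_nil /is_expansion big1 => [|w _]; last by rewrite scale0r.
  exact: equiv_refl.
have [k [v e]] := monom_pi_perm w.
exists (fun u => f@_w * (if u == v then beta ^+ k else 0) + x u).
rewrite big_cons /is_expansion.
have E u : (f@_w * (if u == v then beta ^+ k else 0) + x u) *: pi_perm R u =
  (f@_w * (if u == v then beta ^+ k else 0)) *: pi_perm R u + x u *: pi_perm R u.
  exact: scalerDl.
rewrite (eq_bigr _ (fun u _ => E u)) {E}.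
rewrite big_split.
apply: (equivD _ ex).
rewrite (bigD1 v) //= eqxx big1 ?addr0; last first.
  by move=> u /negbTE ->; rewrite mulr0 scale0r.
rewrite -scalerA; have -> : << f@_w *g w >> = f@_w *: monom w.
  suff -> : monom w = << w >>.
    by apply/malgP => z; rewrite mcoeffZ !mcoeffU mulrnAr mulr1.
  case: w {e} => s; elim: s => [|i s IH].
    by rewrite /monom big_nil; congr mkmalgU; apply/eqP; rewrite fmP fm1.
  rewrite monom_cons /= in IH *; rewrite IH /gen malgM_def fgmulUU mulr1.
  by congr mkmalgU; apply/eqP; rewrite fmP fmM fmU.
exact: equivZ.
Qed.

End Words.

(** * Coefficients of skew permutations *)
Section Coefficients.
Variables (n m : nat) (R : comNzRingType) (beta : R) (q : 'S_n).
Implicit Types (i j k : 'I_n.-1) (u v : 'S_n) (x y : 'I_n).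
Local Notation removable := (@removable n m q).
Local Notation wact := (@wact n m R beta q).
Local Notation act := (@act n m R beta q).

Definition two_increasing u : Prop := forall x y,
  (x < y)%N -> (x < m)%N = (y < m)%N -> (u x < u y)%N.

Definition above u : Prop := forall x, (x < m)%N -> (q x <= u x)%N.

(** The skew diagram between [q] and [u], with (x, l) standing for the box of content
    l + 1 in row m - x: bead x has moved from l to l + 1. *)
Definition boxes u : {set 'I_n * 'I_n.-1} :=
  [set b : 'I_n * 'I_n.-1 | (b.1 < m)%N && (q b.1 <= b.2 < u b.1)%N].

Lemma posK u x : pos u (u x) = x.
Proof. exact: permK. Qed.

Lemma posKV u x : u (pos u x) = x.
Proof. exact: permKV. Qed.

Lemma peelE u j x : peel u j x = simple j (u x).
Proof. by rewrite /peel /pmul permM. Qed.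

Variant simple_spec j x : nat -> Type :=
| SimpleLo of x = j :> nat : simple_spec j x j.+1
| SimpleHi of x = j.+1 :> nat : simple_spec j x j
| SimpleFix of x != j :> nat & x != j.+1 :> nat : simple_spec j x x.

Lemma simpleP j x : simple_spec j x (simple j x).
Proof.
have [e|h1] := eqVneq (x : nat) j.
  by have -> : x = lo j by [apply: val_inj]; rewrite simple_lo; exact: SimpleLo.
have [e|h2] := eqVneq (x : nat) j.+1.
  by have -> : x = hi j by [apply: val_inj]; rewrite simple_hi; exact: SimpleHi.
by rewrite simple_fix //; apply: SimpleFix.
Qed.

Lemma boxes_peel u j : removable u j ->
  boxes u = (pos u (hi j), j) |: boxes (peel u j) /\
  (pos u (hi j), j) \notin boxes (peel u j).
Proof.
case/and3P=> h1 h2 h3; split; last first.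
  by rewrite inE /= peelE posKV simple_hi ltnn !andbF.
apply/setP=> -[x l]; rewrite !inE /= xpair_eqE peelE.
have [->|nx] /= := eqVneq x (pos u (hi j)).
  by rewrite h1 posKV simple_hi -val_eqE /=; move: h3; set z := (q _ : nat); lia.
case xm: (x < m)%N => //=; rewrite simple_fix //.
  by apply: contraTneq h2 => e; rewrite -ltnNge (_ : lo j = u x) ?posK //; apply: val_inj.
by apply: contra_neq nx => e; rewrite (_ : hi j = u x) ?posK //; apply: val_inj.
Qed.

Lemma card_boxes_peel u j : removable u j -> #|boxes u| = #|boxes (peel u j)|.+1.
Proof. by case/boxes_peel => -> nb; rewrite cardsU1 nb. Qed.

Lemma two_increasing_peel u j : (pos u (hi j) < m)%N <> (pos u (lo j) < m)%N ->
  two_increasing u -> two_increasing (peel u j).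
Proof.
move=> sep inc x y xy xym; have := inc x y xy xym; rewrite !peelE.
case: (simpleP j (u x)) => [e1|e1|e1 e1'];
  case: (simpleP j (u y)) => [e2|e2|e2 e2']; try lia.
move=> _; case: sep; rewrite (_ : hi j = u y); last exact: val_inj.
by rewrite (_ : lo j = u x) ?posK //; apply: val_inj.
Qed.

Lemma removable_sep u j : removable u j ->
  (pos u (hi j) < m)%N <> (pos u (lo j) < m)%N.
Proof. by case/and3P=> -> h _; rewrite ltnNge h. Qed.

Lemma above_peel u j : removable u j -> above u <-> above (peel u j).
Proof.
case/and3P=> h1 h2 h3; split=> ab x xm; have := ab x xm; rewrite !peelE.
  case: (simpleP j (u x)) => [e1|e1|e1 e1']; [lia| |by []].
  by move: h3; rewrite (_ : hi j = u x) ?posK //; apply: val_inj.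
case: (simpleP j (u x)) => [e1|e1|e1 e1'] //; last lia.
by move: h2; rewrite leqNgt (_ : lo j = u x) ?posK ?xm //; apply: val_inj.
Qed.

Definition start v : R := (v == q)%:R.

Lemma boxes_q : boxes q = set0.
Proof. by apply/setP=> b; rewrite !inE; lia. Qed.

(** A letter deletes at most one box. *)
Lemma wact_lt a u : (size a < #|boxes u|)%N -> wact a start u = 0.
Proof.
elim: a u => [|j a IH] u /=.
  by rewrite /start; case: eqP => // ->; rewrite boxes_q cards0.
rewrite /delete; case: ifP => // ru; rewrite (card_boxes_peel ru) => h.
by rewrite !IH ?mulr0 ?addr0 ?(card_boxes_peel ru) //; lia.
Qed.

Hypothesis inc_q : two_increasing q.

(** The values off the beads are the complement of those on the beads, listed in
    increasing order. *)
Lemma two_increasing_eq u v : two_increasing u -> two_increasing v ->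
  (forall x, (x < m)%N -> u x = v x) -> u = v.
Proof.
move=> iu iv uv.
have lb (w w' : 'S_n) : two_increasing w -> two_increasing w' ->
    (forall x, (x < m)%N -> w x = w' x) ->
    forall x, (forall y, (y < x)%N -> w y = w' y) -> (w x <= w' x)%N.
  move=> iw iw' e x IH; rewrite leqNgt; apply/negP => lt.
  have wy : w (pos w (w' x)) = w' x by rewrite posKV.
  move: (pos _ _) wy => y wy.
  have xm : (m <= x)%N by rewrite leqNgt; apply/negP => /e ee; move: lt; rewrite ee ltnn.
  case: (ltngtP y x) => yx.
  - by have := IH _ yx; rewrite wy => /perm_inj ee; move: yx; rewrite ee ltnn.
  - have ym : (x < m)%N = (y < m)%N by lia.
    by have := iw _ _ yx ym; rewrite wy; lia.
  - by move: lt; rewrite -wy (val_inj yx) ltnn.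
apply/permP => x; have [s] := ubnP (x : nat); elim: s x => // s IH x lts.
have IH' y : (y < x)%N -> u y = v y by move=> yx; apply: IH; lia.
apply/val_inj/eqP; rewrite eqn_leq !lb // => y ym; first by rewrite uv.
by rewrite IH'.
Qed.

(** Deleting one removable box after another leads from [u] back to [q]. *)
Lemma reach u : two_increasing u -> above u -> exists a,
  [/\ size a = #|boxes u|, pmul (word_perm a) q = u & wact a start u = 1].
Proof.
have [s] := ubnP #|boxes u|; elim: s u => // s IH u lts iu au.
case: (boolP [exists x : 'I_n, (x < m)%N && (q x < u x)%N]) => [|/existsPn none]; last first.
  have uq : u = q.
    apply: two_increasing_eq => // x xm; apply: val_inj; apply/eqP.
    by rewrite eqn_leq au // andbT leqNgt; have := none x; rewrite xm.
  exists [::]; rewrite uq boxes_q cards0; split=> //; first exact: mulg1.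
  by rewrite /= /start eqxx.
case/existsP => x0 hx0.
case: (arg_minnP (P := fun x : 'I_n => (x < m)%N && (q x < u x)%N) (fun x : 'I_n => x : nat) hx0).
(* The lowest displaced bead x can move down, for the bead below it, being still
   at its initial value, is not in the way. *)
move=> x /andP[xm qx] minx.
have ltj : ((u x).-1 < n.-1)%N by have := ltn_ord (u x); lia.
pose j := Ordinal ltj.
have hj : hi j = u x by apply: val_inj => /=; lia.
have ru : removable u j.
  apply/and3P; rewrite hj posK; split=> //; last by rewrite /=; lia.
  rewrite leqNgt; apply/negP => ym.
  have uy : u (pos u (lo j)) = (u x).-1 :> nat by rewrite posKV.
  move: (pos _ _) ym uy => y ym uy.
  have yx : (y < x)%N.
    case: (ltngtP y x) => // [xy|/val_inj e]; last by move: uy; rewrite e; lia.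
    by have := iu _ _ xy; rewrite ym xm => /(_ erefl); lia.
  have := inc_q yx; rewrite ym xm => /(_ erefl).
  have := au y ym; have := minx y; rewrite ym /=; case: ltnP; lia.
have cb := card_boxes_peel ru.
have [|||a [sa pa wa]] := IH (peel u j).
- lia.
- exact: two_increasing_peel (removable_sep ru) iu.
- by apply/(above_peel ru).
exists (j :: a); split.
- by rewrite /= sa cb.
- rewrite word_perm_cons /pmul mulgA -[(q * _)%g]/(pmul (word_perm a) q) pa.
  exact: peelK.
- by rewrite /= /delete ru wact_lt ?mulr0 ?add0r // cb sa.
Qed.

(** On a reduced word no box is ever met twice: otherwise the word obtained by
    deleting the boxes once would be a shorter word of the same permutation. *)
Lemma wact_reduced a u : size a = ell (word_perm a) -> wact a start u != 0 ->
  [/\ wact a start u = 1, u = pmul (word_perm a) q, two_increasing u & above u].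
Proof.
elim: a u => [|j a IH] u red /=.
  rewrite /start; case: (eqVneq u q) => [-> _|]; last by rewrite eqxx.
  by split=> //; rewrite /pmul mulg1.
rewrite /delete; case ru: (removable u j); last by rewrite eqxx.
have reda : size a = ell (word_perm a).
  apply/eqP; rewrite eqn_leq ell_min // andbT.
  have [r rs] := reduced_wordP (word_perm a).
  have := @ell_min _ (word_perm (j :: a)) (j :: reduced_word (word_perm a)).
  by rewrite -red /= r rs => /(_ erefl).
have sep := removable_sep ru.
have w0 : wact a start u = 0.
  apply/eqP; apply/negP => /negP nz; have [_ pu iu au] := IH u reda nz.
  have [b [sb pb _]] := reach (two_increasing_peel sep iu) (iffLR (above_peel ru) au).
  have e : word_perm b = word_perm (j :: a).
    apply: (mulgI q); rewrite -[LHS]/(pmul (word_perm b) q) pb {1}pu.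
    by rewrite word_perm_cons /peel /pmul mulgA.
  have : (#|boxes u| <= size a)%N.
    by rewrite leqNgt; apply: contra nz => /wact_lt ->.
  by have := ell_min e; rewrite -red sb (card_boxes_peel ru) /=; lia.
rewrite w0 mulr0 add0r => nz; have [w1 pu iu au] := IH _ reda nz.
split=> //.
- by rewrite -(peelK u j) pu /peel /pmul mulgA.
- rewrite -(peelK u j); apply: two_increasing_peel iu.
  by rewrite !pos_peel simple_lo simple_hi => /esym.
- exact: (iffRL (above_peel ru)).
Qed.

(** At [u], the only pi_w which can act by a nonzero value on the indicator function
    of [q] is that of w = u q^-1, and its value is then 1. It is not zero: a word
    leading from [q] to [u] acts by 1, and it is a multiple of a single pi_w. *)
Theorem coef_act (f : free_alg n R) u : two_increasing u -> above u ->
  coef beta f (pmul u q^-1%g) = act f start u.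
Proof.
move=> iu au; set w0 := pmul u _.
have red (w : 'S_n) : size (reduced_word w) = ell (word_perm (reduced_word w)).
  by have [-> ->] := reduced_wordP w.
have only (w : 'S_n) : wact (reduced_word w) start u != 0 ->
    w = w0 /\ wact (reduced_word w) start u = 1.
  case/(wact_reduced (red w)) => w1 pu _ _; split=> //.
  by rewrite /w0 pu (reduced_wordP w).1 /pmul mulKg.
have one : wact (reduced_word w0) start u = 1.
  have [a [_ _ wa]] := reach iu au.
  have [d [w /(act_eq m q start u)]] := monom_pi_perm beta a.
  rewrite actZ !act_word wa => e.
  have /only[<- //] : wact (reduced_word w) start u != 0.
  by apply/eqP => z; move/eqP: e; rewrite z mulr0 oner_eq0.
rewrite /coef; set c := epsilon _ _.
have ec : is_expansion beta f c := epsilon_spec _ _ (expansion_exists beta f).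
rewrite (act_eq m q start u ec) act_sum (bigD1 w0) //= big1 ?addr0.
  by rewrite actZ act_word one mulr1.
move=> w nw; rewrite actZ act_word.
case: (eqVneq (wact (reduced_word w) start u) 0) => [->|/only[e _]].
  by rewrite mulr0.
by rewrite e eqxx in nw.
Qed.

End Coefficients.

(** * Grassmannian permutations *)
Section Grassmannian.
Variables (n m : nat).
Implicit Types (i j : 'I_n.-1) (w : 'S_n) (x y : 'I_n).

(** Follow the values at the two positions of the descent along the word: the
    letter that puts them out of order can be removed. *)
Lemma descent_word (a : seq 'I_n.-1) i :
  (word_perm a (hi i) < word_perm a (lo i))%N ->
  exists2 b, (size b < size a)%N & word_perm b = pmul (word_perm a) (simple i).
Proof.
elim: a => [|j a IH]; first by rewrite !perm1 /=; lia.
set v := word_perm a in IH *; rewrite word_perm_cons -/v !permM => lt.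
case: (ltngtP (v (hi i)) (v (lo i))) => [/IH[b sb pb]|lt'|/val_inj/perm_inj e].
- by exists (j :: b); rewrite ?word_perm_cons ?pb //= /pmul mulgA.
- exists a => //; rewrite -/v /pmul.
  have [e1 e2] : v (lo i) = j :> nat /\ v (hi i) = j.+1 :> nat.
    move: lt lt'; case: (simpleP j (v (hi i))) => [?|?|??];
    case: (simpleP j (v (lo i))) => [?|?|??]; lia.
  have -> : simple j = (simple i ^ v)%g.
    by rewrite tpermJ; congr tperm; apply: val_inj.
  by rewrite conjgE mulKVg mulgA simple_sq mul1g.
by move: e => /(congr1 val) /=; lia.
Qed.

Lemma grassmannian_increasing w : grassmannian m w -> two_increasing m w.
Proof.
move=> gw x y xy xym.
have step i : i.+1 <> m -> (w (lo i) < w (hi i))%N.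
  move=> /gw; apply: contraTltn => le.
  have [rw rs] := reduced_wordP w.
  have lt : (word_perm (reduced_word w) (hi i) < word_perm (reduced_word w) (lo i))%N.
    rewrite rw ltn_neqAle le andbT; apply/eqP => /val_inj/perm_inj/(congr1 val) /=.
    by lia.
  have [b sb pb] := descent_word lt.
  by rewrite -leqNgt -rs; apply: leq_trans (ltnW sb); apply: ell_min; rewrite pb rw.
have [d yE] : exists d, y = (x + d.+1)%N :> nat by exists (y - x).-1; lia.
elim: d y yE {xy} xym => [|d IH] y yE xym.
  have lti : (x < n.-1)%N by have := ltn_ord y; lia.
  have := step (Ordinal lti).
  rewrite (_ : lo _ = x); last exact: val_inj.
  by rewrite (_ : hi _ = y); [apply => /=; lia | apply: val_inj => /=; lia].
have lti : (x + d.+1 < n.-1)%N by have := ltn_ord y; lia.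
pose i := Ordinal lti.
have := step i; rewrite (_ : hi _ = y); last by apply: val_inj => /=; lia.
have := IH (lo i) erefl => /=; lia.
Qed.

Lemma grassmannian_part la w (x : 'I_n) : grassmannian_of m la w ->
  (x < m)%N -> w x = (part la (m - x) + x)%N :> nat.
Proof.
case=> _ h xm; have := h (m - x)%N.
rewrite (_ : (m.+1 - (m - x))%N = x.+1); last lia.
rewrite /one_line /=; case: insubP => [y _ /val_inj ->|]; last by rewrite ltn_ord.
by move=> /(_ ltac:(lia)); lia.
Qed.

Lemma grassmannian_part0 la w (x : nat) : grassmannian_of m la w ->
  (n <= x < m)%N -> part la (m - x) = 0%N.
Proof.
case=> _ h xm; have := h (m - x)%N.
rewrite (_ : (m.+1 - (m - x))%N = x.+1); last lia.
rewrite /one_line /=; case: insubP => [y hy|_]; first by lia.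
by move=> /(_ ltac:(lia)); lia.
Qed.

End Grassmannian.

(** * Fillings by times *)
Section Placements.
Variables (n m : nat) (R : comNzRingType) (beta : R) (q : 'S_n).
Variables (T : finType) (k : T -> 'I_n.-1) (t : T -> R) (lt : rel T).
Hypotheses (lt_irr : irreflexive lt) (lt_trans : transitive lt).
Hypothesis inc_q : two_increasing m q.
Implicit Types (u : 'S_n) (x y : 'I_n) (p : T) (s : seq T).
Implicit Types (b : 'I_n * 'I_n.-1) (V : {set 'I_n * T}).
Local Notation removable := (@removable n m q).
Local Notation boxes := (@boxes n m q).
Local Notation act := (@act n m R beta q).
Local Notation start := (@start n R q).

(** The order of boxes along rows and columns: bead x is row m - x and contents
    increase by 1 along rows, so the boxes of a column are those with the same
    difference of content and bead. *)
Definition precedes b b' : bool :=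
  ((b.1 == b'.1) && (b.2 < b'.2)%N) || ((b'.1 < b.1)%N && (b.2 + b'.1 == b'.2 + b.1)%N).

Lemma two_increasing_gap u x y : two_increasing m u -> (x < y)%N -> (y < m)%N ->
  (u x + (y - x) <= u y)%N.
Proof.
move=> iu xy ym; have [d yE] : exists d, y = (x + d.+1)%N :> nat by exists (y - x).-1; lia.
elim: d y yE {xy} ym => [|d IH] y yE ym.
  by have := iu x y; rewrite yE; lia.
have ltz : (x + d.+1 < n)%N by have := ltn_ord y; lia.
have := IH (Ordinal ltz) erefl; have := iu (Ordinal ltz) y => /=; lia.
Qed.

(** A box below the corner in its column would force the beads between the two rows
    to be packed right up to value j, which no bead takes. *)
Lemma corner_last u j b : two_increasing m u -> removable u j -> b \in boxes u ->
  ~~ precedes (pos u (hi j), j) b.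
Proof.
move=> iu /and3P[h1 h2 _]; rewrite inE => /andP[bm bb].
have ux : u (pos u (hi j)) = j.+1 :> nat by rewrite posKV.
move: (pos u (hi j)) h1 ux => x xm ux.
apply/negP => /orP[/andP[/eqP e /= lt1]|/= /andP[lt1 /eqP e]].
  by move: bb; rewrite -e ux; lia.
have ltz : (x.-1 < n)%N by have := ltn_ord x; lia.
pose z := Ordinal ltz.
have zj : u z <> j :> nat.
  move=> uz; move: h2; rewrite (_ : lo j = u z) ?posK /=; last exact: val_inj.
  by lia.
have uzx : (u z < u x)%N by apply: iu => /=; lia.
have : (u b.1 + (z - b.1) <= u z)%N.
  have [bz|bz] := ltnP b.1 z; first by apply: two_increasing_gap => //=; lia.
  have -> : b.1 = z by apply: val_inj => /=; move: bz => /=; lia.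
  by rewrite subnn addn0.
by move: bb => /=; lia.
Qed.

(** If value j were taken by a bead, it would be the bead just below x, and the box
    below (x, j) would belong to the diagram. *)
Lemma last_corner u x j : two_increasing m u ->
  (x, j) \in boxes u -> (forall b, b \in boxes u -> ~~ precedes (x, j) b) ->
  removable u j /\ x = pos u (hi j).
Proof.
move=> iu; rewrite inE /= => /andP[xm /andP[qj ju]] last.
have ux : u x = j.+1 :> nat.
  case: (ltngtP (u x) j.+1) => // h; first lia.
  have ltj : (j.+1 < n.-1)%N by have := ltn_ord (u x); lia.
  have := last (x, Ordinal ltj); rewrite inE /= xm /precedes /= eqxx ltnSn /=.
  by lia.
have hx : hi j = u x by apply: val_inj.
rewrite hx posK; split=> //; apply/and3P; rewrite hx posK; split=> //.
rewrite leqNgt; apply/negP.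
have : u (pos u (lo j)) = j :> nat by rewrite posKV.
move: (pos u (lo j)) => y uy ym.
have yx : (y < x)%N.
  case: (ltngtP y x) => // [xy|/val_inj e]; last by move: uy; rewrite e; lia.
  by have := iu _ _ xy; lia.
have qyx : (q y < q x)%N by apply: inc_q => //; lia.
have xy1 : x = y.+1 :> nat.
  by have := two_increasing_gap iu yx xm; lia.
have ltj : (j.-1 < n.-1)%N by have := ltn_ord j; lia.
by have := last (y, Ordinal ltj); rewrite inE /precedes /=; lia.
Qed.

Definition cell (p : 'I_n * T) : 'I_n * 'I_n.-1 := (p.1, k p.2).

(** A filling of the diagram by nonempty sets of times, increasing along rows and
    columns. A time p can only be in a box of content k p, so the pair of a row and
    p determines the box, and a set of such pairs describes a filling. *)
Definition placement s u V : bool :=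
  [&& cell @: V == boxes u,
      [forall e in V, e.2 \in s] &
      [forall e in V, forall e' in V, precedes (cell e) (cell e') ==> lt e.2 e'.2]].

Lemma placementP s u V :
  reflect [/\ cell @: V = boxes u, forall e, e \in V -> e.2 \in s &
    forall e e', e \in V -> e' \in V -> precedes (cell e) (cell e') -> lt e.2 e'.2]
  (placement s u V).
Proof.
apply: (iffP and3P) => [[/eqP h1 /forall_inP h2 /forall_inP h3]|[h1 h2 h3]]; split=> //.
- by move=> e e' eV e'V; have /forall_inP/(_ _ e'V)/implyP := h3 _ eV.
- by apply/eqP.
- exact/forall_inP.
apply/forall_inP => e eV; apply/forall_inP => e' e'V; apply/implyP; exact: h3.
Qed.

Definition weight u V : R :=
  beta ^+ (#|V| - #|boxes u|) * \prod_(e in V) t e.2.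

Lemma lt_asym p p' : lt p p' -> lt p' p = false.
Proof. by move=> h; apply/negP => /(lt_trans h); rewrite lt_irr. Qed.

Section Step.
Variables (p : T) (s : seq T) (u : 'S_n).
Hypotheses (s_lt : all (fun p' => lt p' p) s) (iu : two_increasing m u).
Local Notation e0 := (pos u (hi (k p)), p).

Lemma placement_fresh v V : placement s v V -> forall e, e \in V -> e.2 <> p.
Proof.
case/placementP => _ h _ e eV ep; have := allP s_lt _ (h _ eV).
by rewrite ep lt_irr.
Qed.

(** The last time p comes after all others, so nothing lies to the right of its box
    or below it. *)
Lemma placement_last V e : placement (p :: s) u V -> e \in V -> e.2 = p ->
  removable u (k p) /\ e = e0.
Proof.
case/placementP => h1 h2 h3 eV ep.
have ce : cell e = (e.1, k p) by rewrite /cell ep.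
have [|b|ru ex] := @last_corner u e.1 (k p) iu.
- by rewrite -ce -h1 imset_f.
- rewrite -h1 -ce => /imsetP[e' e'V ->]; apply/negP => /(h3 _ _ eV e'V).
  have := h2 _ e'V; rewrite inE ep => /orP[/eqP ->|e's]; first by rewrite lt_irr.
  by rewrite (lt_asym (allP s_lt _ e's)).
by split=> //; rewrite -ex -ep; case: e {eV ep ce ex}.
Qed.

Lemma placement_skip V :
  placement (p :: s) u V && ~~ [exists e in V, e.2 == p] = placement s u V.
Proof.
apply/andP/idP => [[/placementP[h1 h2 h3] /exists_inPn nop]|pV].
  apply/placementP; split=> // e eV; have := h2 e eV.
  by rewrite inE (negbTE (nop _ eV)).
split; last by apply/exists_inPn => e eV; apply/eqP/(placement_fresh pV).
case/placementP: pV => h1 h2 h3; apply/placementP; split=> // e eV.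
by rewrite inE h2 ?orbT.
Qed.

(** Remove the last time from its corner: either the corner still has earlier
    times, or its box is gone. *)
Lemma placement_use V : removable u (k p) -> e0 \notin V ->
  placement (p :: s) u (e0 |: V) =
  placement s u V || placement s (peel u (k p)) V.
Proof.
move=> ru nV; have [bE bN] := boxes_peel ru.
apply/idP/orP => [pV|].
  have sub : cell @: V \subset boxes u.
    by case/placementP: (pV) => <- _ _; apply/imsetS/subsetUr.
  have sV e : e \in V -> e.2 \in s.
    move=> eV; have eV' : e \in e0 |: V by rewrite in_setU1 eV orbT.
    case/placementP: (pV) => _ /(_ _ eV') + _; rewrite inE => /orP[/eqP ep|//].
    by have [_ ee] := placement_last pV eV' ep; rewrite -ee eV in nV.
  case/placementP: pV => h1 h2 h3.
  have ord e e' : e \in V -> e' \in V -> precedes (cell e) (cell e') -> lt e.2 e'.2.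
    by move=> eV e'V; apply: h3; rewrite in_setU1 ?eV ?e'V orbT.
  rewrite imsetU1 in h1.
  case: (boolP (cell e0 \in cell @: V)) => ce; [left|right]; apply/placementP; split=> //.
    by rewrite -h1; apply/esym/setUidPr; rewrite sub1set.
  apply/setP => b; have := congr1 (fun A : {set _} => b \in A) h1.
  rewrite bE !in_setU1 /cell /= -/(cell _).
  by case: eqP => // -> _; rewrite (negbTE ce) (negbTE bN).
have main v : (cell e0 |: cell @: V) = boxes u -> placement s v V ->
    placement (p :: s) u (e0 |: V).
  move=> hb /placementP[_ h2 h3]; apply/placementP; split.
  - by rewrite imsetU1.
  - by move=> e; rewrite !inE => /orP[/eqP ->|/h2 ->]; rewrite ?eqxx ?orbT.
  move=> e e'; rewrite !in_setU1 => /orP[/eqP ->|eV] /orP[/eqP ->|e'V].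
  - by rewrite /precedes /= eqxx !ltnn andbF.
  - move=> pr; have := @corner_last u (k p) (cell e') iu ru.
    by rewrite -hb in_setU1 imset_f ?orbT //= => /(_ isT); rewrite pr.
  - by move=> _; apply: (allP s_lt); apply: h2.
  - exact: h3.
case=> pV; apply: main (pV); case/placementP: (pV) => -> _ _.
  by apply/setUidPr; rewrite sub1set bE setU11.
by rewrite bE.
Qed.

Lemma weight_use V : placement s u V -> e0 \notin V ->
  weight u (e0 |: V) = t p * (beta * weight u V).
Proof.
move=> /placementP[h1 _ _] nV; rewrite /weight big_setU1 //= cardsU1 nV.
have le : (#|boxes u| <= #|V|)%N by rewrite -h1 leq_imset_card.
by rewrite add1n subSn // exprS !mulrA; congr (_ * _); rewrite mulrC mulrA.
Qed.

Lemma weight_peel V : removable u (k p) -> e0 \notin V ->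
  weight u (e0 |: V) = t p * weight (peel u (k p)) V.
Proof.
move=> ru nV; rewrite /weight big_setU1 //= cardsU1 nV (card_boxes_peel ru).
by rewrite add1n subSS mulrCA.
Qed.

(** The sum obeys the recursion by which a factor 1 + t_p pi_(k p) acts. *)
Lemma sum_placement :
  \sum_(V | placement (p :: s) u V) weight u V =
  \sum_(V | placement s u V) weight u V +
  t p * (if removable u (k p) then
    beta * (\sum_(V | placement s u V) weight u V) +
    \sum_(V | placement s (peel u (k p)) V) weight (peel u (k p)) V else 0).
Proof.
rewrite (bigID (fun V : {set 'I_n * T} => [exists e in V, e.2 == p])) /= addrC.
congr (_ + _); first exact: (eq_bigl _ _ placement_skip).
case ru: (removable u (k p)); last first.
  rewrite mulr0 big1 // => V /andP[pV /exists_inP[e eV /eqP ep]].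
  by have [] := placement_last pV eV ep; rewrite ru.
rewrite (reindex_onto (fun V => e0 |: V) (fun V => V :\ e0)) /=; last first.
  move=> V /andP[pV /exists_inP[e eV /eqP ep]]; apply: setD1K.
  by have [_ <-] := placement_last pV eV ep.
have fresh v V : placement s v V -> e0 \notin V.
  by move=> pV; apply/negP => /(placement_fresh pV); apply.
set v := peel u (k p).
have dom V : placement (p :: s) u (e0 |: V) && [exists e in e0 |: V, e.2 == p] &&
    ((e0 |: V) :\ e0 == V) = placement s u V || placement s v V.
  have -> : [exists e in e0 |: V, e.2 == p].
    by apply/exists_inP; exists e0; rewrite ?setU11 /=.
  rewrite andbT; case: (boolP (e0 \in V)) => eV.
    transitivity false; last first.
      by apply/esym/norP; split; apply: contraL eV; apply: fresh.
    by apply/negbTE/nandP; right; apply/eqP => e; move: eV; rewrite -e !inE eqxx.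
  by rewrite setU1K // eqxx andbT placement_use.
have excl V : placement s v V -> ~~ placement s u V.
  case/placementP=> hv _ _; apply/negP => /placementP[hu _ _].
  have [bE bN] := boxes_peel ru; move: bN; rewrite -/v -hv hu bE.
  by rewrite setU11.
rewrite (eq_bigl _ _ dom) (bigID (placement s u)) /= mulrDr !big_distrr /=.
congr (_ + _); apply: eq_big => V.
- by case: (placement s u V); rewrite ?andbF.
- by case/andP=> _ pV; rewrite weight_use ?(fresh _ _ pV).
- case: (boolP (placement s v V)) => [/excl->|_]; rewrite ?orbT ?orbF //.
  by rewrite andbN.
case/andP=> /orP[->//|pV _]; by rewrite weight_peel ?(fresh _ _ pV).
Qed.

End Step.

Theorem act_prod_placements s u :
  pairwise (fun p p' => lt p' p) s -> two_increasing m u -> above m q u ->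
  act (\prod_(p <- s) (1 + t p *: gen R (k p))) start u =
  \sum_(V | placement s u V) weight u V.
Proof.
elim: s u => [|p s IH] u; last first.
  rewrite pairwise_cons => /andP[ps ss] iu au.
  rewrite big_cons mulrDl mul1r actD -scalerAl actZ act_genM.
  rewrite (sum_placement ps iu) -IH // /delete.
  case: ifP => // ru; congr (_ + _ * (_ + _)); apply: IH => //.
    exact: two_increasing_peel (removable_sep ru) iu.
  exact/(above_peel ru).
move=> _ iu au; rewrite big_nil act1 /start.
have pE V : placement [::] u V = (V == set0) && (u == q).
  apply/placementP/andP => [[h1 h2 _]|[/eqP -> /eqP ->]]; last first.
    by rewrite imset0 boxes_q; split=> // e; rewrite ?inE // => e'; rewrite inE.
  have V0 : V = set0 by apply/setP => e; rewrite inE; apply/negP => /h2.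
  rewrite V0 eqxx; split=> //; apply/eqP; apply: two_increasing_eq iu inc_q _ => x xm.
  apply/val_inj/eqP; rewrite eqn_leq au // andbT leqNgt; apply/negP => /= qu.
  have ltj : (q x < n.-1)%N by have := ltn_ord (u x); lia.
  have : (x, Ordinal ltj) \in boxes u by rewrite inE /= xm leqnn.
  by rewrite -h1 V0 imset0 inE.
rewrite (eq_bigl _ _ pE); case: eqP => [->|_]; last first.
  by rewrite big1 // => V; rewrite andbF.
under eq_bigl do rewrite andbT.
by rewrite big_pred1_eq /weight boxes_q !cards0 big_set0 mulr1.
Qed.

End Placements.

(** * The times of a double Grothendieck polynomial *)
Section Times.
Variable n : nat.
Local Notation time := (letter n * 'I_n.-1)%type.
Implicit Types (a : letter n) (l : 'I_n.-1) (p : time).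

Definition letter_index a : 'I_n.-1 := match a with inl i => i | inr i => i end.

(** A marked letter sweeps the contents upwards and an unmarked one downwards,
    so that a marked letter can be used repeatedly along a row only, and an
    unmarked one along a column only. *)
Definition earlier p p' : bool :=
  (key p.1 < key p'.1)%R ||
  ((p.1 == p'.1) && (if marked p.1 then p.2 < p'.2 else p'.2 < p.2)%N).

Lemma key_inj : injective (@key n).
Proof.
move=> [i|i] [j|j] /= h; try lia.
  by congr inl; apply: val_inj => /=; lia.
by congr inr; apply: val_inj => /=; lia.
Qed.

Lemma earlier_irr : irreflexive earlier.
Proof. by move=> p; rewrite /earlier ltxx !ltnn if_same andbF. Qed.

Lemma earlier_trans : transitive earlier.
Proof.
move=> [a2 l2] [a1 l1] [a3 l3]; rewrite /earlier /=.
case/orP=> [h1|/andP[/eqP -> h1]]; case/orP=> [h2|/andP[/eqP <- h2]].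
- by rewrite (lt_trans h1 h2).
- by rewrite h1.
- by rewrite h2.
by rewrite eqxx; case: (marked a2) h1 h2 => h1 h2; apply/orP; right; lia.
Qed.

(** In the order of the factors of the product, that is from the last time to the
    first one. *)
Definition times : seq time :=
  [seq (inr i : letter n, j) | i <- rev (enum 'I_n.-1), j <- [seq j : 'I_n.-1 <- enum 'I_n.-1 | (i <= j)%N]] ++
  [seq (inl i : letter n, j) | i <- enum 'I_n.-1, j <- [seq j : 'I_n.-1 <- rev (enum 'I_n.-1) | (i <= j)%N]].

Lemma mem_times a l : ((a, l) \in times) = (letter_index a <= l)%N.
Proof.
rewrite mem_cat; apply/orP/idP.
  by case=> /allpairsPdep[i [j [_]]]; rewrite mem_filter => /andP[h _] [-> ->].
case: a => i h; [right|left]; apply/allpairsPdep; exists i, l.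
  by split; rewrite ?mem_enum // mem_filter mem_rev mem_enum andbT.
by split; rewrite ?mem_rev ?mem_enum // mem_filter mem_enum andbT.
Qed.

Lemma pairwise_rev (T : Type) (r : rel T) s :
  pairwise r (rev s) = pairwise (fun x y => r y x) s.
Proof. by elim: s => //= x s IH; rewrite rev_cons pairwise_rcons all_rev IH. Qed.

Lemma pairwise_enum_ord k : pairwise (fun i j : 'I_k => (i < j)%N) (enum 'I_k).
Proof.
rewrite -(@pairwise_map _ _ val ltn) val_enum_ord -sorted_pairwise ?iota_ltn_sorted //.
exact: ltn_trans.
Qed.

Lemma pairwise_allpairs (S T U : eqType) (h : S -> T -> U) (g : S -> seq T)
    (r : rel S) (e : rel U) xs :
  pairwise r xs -> (forall i, pairwise (fun j j' => e (h i j) (h i j')) (g i)) ->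
  (forall i i' j j', r i i' -> e (h i j) (h i' j')) ->
  pairwise e [seq h i j | i <- xs, j <- g i].
Proof.
move=> + pg re; elim: xs => //= i xs IH /andP[ri pxs].
rewrite pairwise_cat pairwise_map pg IH // !andbT.
apply/allrelP => _ _ /mapP[j _ ->] /allpairsPdep[i' [j' [i'xs _ ->]]].
by apply: re; apply: (allP ri).
Qed.

Lemma times_sorted : pairwise (fun p p' => earlier p' p) times.
Proof.
rewrite pairwise_cat; apply/and3P; split.
- apply/allrelP => _ _ /allpairsPdep[i [j [_ _ ->]]] /allpairsPdep[i' [j' [_ _ ->]]].
  by rewrite /earlier /=; lia.
- apply: (@pairwise_allpairs _ _ _ _ _ (fun i i' : 'I_n.-1 => i' < i)%N).
  + by rewrite pairwise_rev pairwise_enum_ord.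
  + move=> i; apply: pairwise_filter; apply: sub_pairwise (pairwise_enum_ord _).
    by move=> j j' h; rewrite /earlier /= eqxx h orbT.
  by move=> i i' j j' h; rewrite /earlier /=; lia.
apply: (@pairwise_allpairs _ _ _ _ _ (fun i i' : 'I_n.-1 => i < i')%N).
+ exact: pairwise_enum_ord.
+ move=> i; apply: pairwise_filter; rewrite pairwise_rev.
  apply: sub_pairwise (pairwise_enum_ord _).
  by move=> j j' h; rewrite /earlier /= eqxx h orbT.
by move=> i i' j j' h; rewrite /earlier /=; lia.
Qed.

Definition time_weight (R : comNzRingType) (x y : nat -> R) (a : letter n) : R :=
  match a with inl i => x i.+1 | inr i => y i.+1 end.

Lemma prod_times (R : comNzRingType) (x y : nat -> R) :
  (\prod_(i <- rev (enum 'I_n.-1)) @A'_ n R i (y i.+1)) *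
  (\prod_(i <- enum 'I_n.-1) @A_ n R i (x i.+1)) =
  \prod_(p <- times) (1 + time_weight x y p.1 *: gen R p.2) :> free_alg n R.
Proof.
rewrite big_cat /= !big_allpairs_dep; congr (_ * _).
  by apply: eq_bigr => i _; rewrite big_filter.
by apply: eq_bigr => i _; rewrite big_filter.
Qed.

End Times.

(** * Bitableaux *)
Section Bitableaux.
Variables (n m : nat) (la mu : seq nat) (wla wmu : 'S_n).
Hypothesis la_part : is_partition la.
Hypotheses (gla : grassmannian_of m la wla) (gmu : grassmannian_of m mu wmu).
Local Notation box := (box m la mu).
Local Notation filling := (filling n m la mu).
Local Notation letter := (letter n).
Local Notation time := (letter * 'I_n.-1)%type.
Local Notation boxes := (boxes m wmu wla).
Implicit Types (b : box) (a : letter) (U : filling) (V : {set 'I_n * time}).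

Local Arguments box_row : simpl never.
Local Arguments box_col : simpl never.

Lemma box_rowP b : (0 < box_row b <= m)%N.
Proof. by rewrite /box_row ltn_ord. Qed.

Lemma box_colP b :
  (part mu (box_row b) < box_col b <= part la (box_row b))%N.
Proof. exact: (valP b). Qed.

Lemma bead_lt b : (m - box_row b < n)%N.
Proof.
rewrite ltnNge; apply/negP => h; have := box_rowP b; have := box_colP b.
have := @grassmannian_part0 _ _ _ _ (m - box_row b) gla.
have -> : (m - (m - box_row b))%N = box_row b by have := box_rowP b; lia.
by move=> e ? ?; have := e ltac:(lia); lia.
Qed.

Definition bead b : 'I_n := Ordinal (bead_lt b).

Lemma beadE b : bead b = (m - box_row b)%N :> nat.
Proof. by []. Qed.

Lemma bead_lt_m b : (bead b < m)%N.
Proof. by rewrite beadE; have := box_rowP b; lia. Qed.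

Lemma wla_bead b : wla (bead b) = (part la (box_row b) + (m - box_row b))%N :> nat.
Proof.
rewrite (grassmannian_part gla (bead_lt_m b)) beadE.
by congr (part _ _ + _)%N; have := box_rowP b; lia.
Qed.

Lemma wmu_bead b : wmu (bead b) = (part mu (box_row b) + (m - box_row b))%N :> nat.
Proof.
rewrite (grassmannian_part gmu (bead_lt_m b)) beadE.
by congr (part _ _ + _)%N; have := box_rowP b; lia.
Qed.

Lemma content_lt b : ((box_col b + (m - box_row b)).-1 < n.-1)%N.
Proof.
have := box_colP b; have := ltn_ord (wla (bead b)); rewrite wla_bead; lia.
Qed.

(** Zero-based: a box of content c is added by s_c, the generator of index c - 1. *)
Definition content b : 'I_n.-1 := Ordinal (content_lt b).

Definition place b := (bead b, content b).

Lemma contentE b : content b = (box_col b + (m - box_row b)).-1 :> nat.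
Proof. by []. Qed.


Lemma place_inj : injective place.
Proof.
move=> b b' e.
have e1 : bead b = bead b' :> nat by have := congr1 (fun c : 'I_n * 'I_n.-1 => c.1 : nat) e.
have e2 : content b = content b' :> nat by have := congr1 (fun c : 'I_n * 'I_n.-1 => c.2 : nat) e.
rewrite !beadE in e1; rewrite !contentE in e2.
have := box_rowP b; have := box_rowP b'; have := box_colP b; have := box_colP b'.
move=> h1 h2 h3 h4.
have er : box_row b = box_row b' by lia.
have ec : box_col b = box_col b'. by rewrite er in e2 h2; lia.
move: er ec => /succn_inj/val_inj er /succn_inj/val_inj ec.
by apply: val_inj; rewrite [LHS]surjective_pairing er ec -surjective_pairing.
Qed.

Lemma place_boxes b : place b \in boxes.
Proof.
rewrite inE -[(place b).1]/(bead b) -[(place b).2]/(content b).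
by rewrite bead_lt_m wla_bead wmu_bead contentE; have := box_colP b; lia.
Qed.

Lemma part_le1 i : (part la i <= part la 1)%N.
Proof.
case/andP: la_part => srt _; rewrite /part.
have [le|lt] := leqP (size la) i.-1; first by rewrite nth_default.
apply: (sorted_leq_nth (leT := geq)) => //; rewrite ?inE //; last by lia.
- by move=> x y z h1 h2; apply: leq_trans h2 h1.
- by move=> x; apply: leqnn.
Qed.

Lemma place_surj c : c \in boxes -> exists b, place b = c.
Proof.
case: c => x l; rewrite inE /= => /andP[xm xl].
have := grassmannian_part gla xm; have := grassmannian_part gmu xm => hmu hla.
have lti : (m - x.+1 < m)%N by lia.
have ltj : (l - x < part la 1)%N by have := part_le1 (m - x); lia.
have sk : @in_skew m la mu (Ordinal lti, Ordinal ltj).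
  rewrite /in_skew /= (_ : (m - x.+1).+1 = (m - x)%N); last lia.
  by lia.
exists (exist (@in_skew m la mu) _ sk : box); congr pair; apply: val_inj => /=.
  by rewrite /box_row /=; lia.
by rewrite /box_row /box_col /=; lia.
Qed.

Lemma box_in_row b (c : nat) : (part mu (box_row b) < c <= part la (box_row b))%N ->
  exists2 b' : box, box_row b' = box_row b & box_col b' = c.
Proof.
move=> hc; have ltj : (c.-1 < part la 1)%N by have := part_le1 (box_row b); lia.
have sk : @in_skew m la mu ((val b).1, Ordinal ltj).
  change (part mu (box_row b) < c.-1.+1 <= part la (box_row b))%N; lia.
exists (exist (@in_skew m la mu) _ sk : box) => //.
by rewrite /box_col /=; lia.
Qed.

Lemma precedes_place b b' : precedes (place b) (place b') =
  ((box_row b == box_row b') && (box_col b < box_col b')%N) ||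
  ((box_col b == box_col b') && (box_row b < box_row b')%N).
Proof.
have -> : precedes (place b) (place b') =
    ((bead b == bead b' :> nat) && (content b < content b')%N) ||
    ((bead b' < bead b)%N && (content b + bead b' == content b' + bead b)%N) by [].
rewrite !beadE !contentE.
have := box_rowP b; have := box_rowP b'; have := box_colP b; have := box_colP b'.
by lia.
Qed.

Definition entry (e : box * letter) : 'I_n * time := (bead e.1, (e.2, content e.1)).

Definition placement_of U : {set 'I_n * time} :=
  entry @: [set e : box * letter | e.2 \in U e.1].

Definition filling_of V : filling :=
  [ffun b => [set a | (bead b, (a, content b)) \in V]].

Lemma entry_inj : injective entry.
Proof.
move=> [b a] [b' a'] [e1 e2 e3].
have -> : b = b' by apply: place_inj; congr pair; apply: val_inj.
by rewrite e2.
Qed.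

Lemma mem_placement_of U b a :
  ((bead b, (a, content b)) \in placement_of U) = (a \in U b).
Proof. by rewrite -[(_, _)]/(entry (b, a)) mem_imset ?inE //; apply: entry_inj. Qed.

Lemma placement_ofK U : filling_of (placement_of U) = U.
Proof.
by apply/ffunP => b; rewrite ffunE; apply/setP => a; rewrite inE mem_placement_of.
Qed.

Lemma filling_ofK V : (cell (fun p : time => p.2)) @: V = boxes ->
  placement_of (filling_of V) = V.
Proof.
move=> cV; apply/setP => -[x [a l]]; apply/imsetP/idP => [[[b a'] + ->]|xV].
  by rewrite !inE ffunE inE.
have : (x, l) \in boxes by rewrite -cV; apply/imsetP; exists (x, (a, l)).
case/place_surj => b [bx bl]; exists (b, a); last by rewrite /entry /= bx bl.
by rewrite inE /= ffunE inE bx bl.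
Qed.

Lemma big_placement_of (R : Type) (idx : R) (op : Monoid.com_law idx)
    (F : 'I_n * time -> R) U :
  \big[op/idx]_(e in placement_of U) F e =
  \big[op/idx]_b \big[op/idx]_(a in U b) F (entry (b, a)).
Proof.
rewrite big_imset /=; last by move=> e e' _ _; apply: entry_inj.
rewrite pair_big_dep /=; apply: eq_big => [[b a]|[b a] _] //=.
by rewrite inE.
Qed.

Lemma card_placement_of U : #|placement_of U| = total_size U.
Proof.
rewrite -sum1_card big_placement_of; apply: eq_bigr => b _; exact: sum1_card.
Qed.

Lemma prod_placement_of (R : comNzRingType) (x y : nat -> R) U :
  \prod_(e in placement_of U) time_weight x y e.2.1 = monomial x y U.
Proof.
rewrite big_placement_of /= (exchange_big_dep xpredT) //= big_sumType /=.
by congr (_ * _); apply: eq_bigr => i _; rewrite prodr_const; congr (_ ^+ _);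
  apply: eq_card => b; rewrite inE.
Qed.

Lemma sum_interval (N c d : nat) : (d <= N)%N ->
  (\sum_(j < N) (c < j.+1 <= d) = d - c)%N.
Proof.
move=> dN; suff -> : (\sum_(j < N) (c < j.+1 <= d) = minn d N - c)%N by lia.
elim: N {dN} => [|N IH]; first by rewrite big_ord0; lia.
by rewrite big_ord_recr /= IH; lia.
Qed.

Lemma card_boxes : #|boxes| = skew_size m la mu.
Proof.
have -> : boxes = place @: [set: box].
  apply/setP => c; apply/idP/imsetP => [/place_surj[b <-]|[b _ ->]].
    by exists b; rewrite ?inE.
  exact: place_boxes.
rewrite card_imset ?cardsT; last exact: place_inj.
rewrite card_sig /skew_size big_add1 /= big_mkord.
transitivity (\sum_(i < m) \sum_(j < part la 1) in_skew mu (i, j))%N.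
  rewrite -sum1_card big_mkcond pair_big /=; apply: eq_bigr => -[i j] _.
  by rewrite inE /=; case: (in_skew _ _).
by apply: eq_bigr => i _; rewrite /in_skew /= sum_interval // part_le1.
Qed.


Local Notation content_of := (fun p : time => p.2).
Local Notation valid U :=
  (placement m wmu content_of (@earlier n) (times n) wla (placement_of U)).

Lemma valid_placementP U : reflect
  [/\ forall b, U b != set0,
      forall b a, a \in U b -> (letter_index a <= content b)%N &
      forall b b' a a', a \in U b -> a' \in U b' -> precedes (place b) (place b') ->
        earlier (a, content b) (a', content b')]
  (valid U).
Proof.
apply: (iffP (placementP _ _ _ _ _ _ _)) => [[h1 h2 h3]|[h1 h2 h3]]; split.
- move=> b; have : place b \in boxes by apply: place_boxes.
  rewrite -h1 => /imsetP[_ /imsetP[[b' a] + ->] /place_inj ->].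
  by rewrite inE => aU; apply/set0Pn; exists a.
- move=> b a aU; rewrite -mem_times.
  by apply: (h2 (entry (b, a))); rewrite mem_placement_of.
- move=> b b' a a' aU aU'; apply: (h3 (entry (b, a)) (entry (b', a')));
  by rewrite mem_placement_of.
- apply/setP => c; apply/imsetP/idP => [[_ /imsetP[[b a] _ ->] ->]|/place_surj[b <-]].
    exact: place_boxes.
  have [a aU] := set0Pn _ (h1 b).
  by exists (entry (b, a)); rewrite ?mem_placement_of.
- by move=> _ /imsetP[[b a] + ->]; rewrite inE mem_times; apply: h2.
by move=> _ _ /imsetP[[b a] + ->] /imsetP[[b' a'] + ->]; rewrite !inE; apply: h3.
Qed.

(** Unmarked entries increase strictly along a row, hence at least as fast as the
    contents; so the upper flag bound, which is the content bound at the last box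
    of the row, gives the content bound at every box. *)
Lemma bitableau_valid U : is_bitableau U -> valid U.
Proof.
case/and5P=> /forallP h1 h2 h3 h4 /andP[h5 h6].
have row b b' a a' : box_row b = box_row b' -> (box_col b < box_col b')%N ->
    a \in U b -> a' \in U b' -> (key a <= key a')%R /\ (a = a' -> marked a).
  move=> er ec aU aU'; have rc : (box_row b == box_row b') && (box_col b < box_col b')%N.
    by rewrite er eqxx.
  have /forallP/(_ b')/implyP/(_ rc)/forall_inP/(_ _ aU)/forall_inP/(_ _ aU') := forallP h2 b.
  split=> // e; have /forallP/(_ b')/implyP/(_ rc)/forallP/(_ a) := forallP h5 b.
  by rewrite aU e aU'; case: (marked a').
have col b b' a a' : box_col b = box_col b' -> (box_row b < box_row b')%N ->
    a \in U b -> a' \in U b' -> (key a <= key a')%R /\ (a = a' -> ~~ marked a).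
  move=> ec er aU aU'; have rc : (box_col b == box_col b') && (box_row b < box_row b')%N.
    by rewrite ec eqxx.
  have /forallP/(_ b')/implyP/(_ rc)/forall_inP/(_ _ aU)/forall_inP/(_ _ aU') := forallP h3 b.
  split=> // e; have /forallP/(_ b')/implyP/(_ rc)/forallP/(_ a) := forallP h4 b.
  by rewrite aU e aU'; case: (marked a').
have ord b b' a a' : a \in U b -> a' \in U b' -> precedes (place b) (place b') ->
    earlier (a, content b) (a', content b').
  move=> aU aU'; rewrite precedes_place => /orP[/andP[/eqP e1 e2]|/andP[/eqP e1 e2]].
    have [le mk] := row _ _ _ _ e1 e2 aU aU'.
    rewrite /earlier; move: le; rewrite le_eqVlt => /orP[/eqP/key_inj e|-> //].
    apply/orP; right; rewrite -[(_, _).1]/a -[(_, _).2]/(content b) e eqxx -e mk //.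
    by rewrite !contentE e1; have := box_colP b; lia.
  have [le mk] := col _ _ _ _ e1 e2 aU aU'.
  rewrite /earlier; move: le; rewrite le_eqVlt => /orP[/eqP/key_inj e|-> //].
  apply/orP; right; rewrite -[(_, _).1]/a -[(_, _).2]/(content b) e eqxx -e (negbTE (mk e)).
  change (content b' < content b)%N; rewrite !contentE e1.
  have := box_rowP b'; have := box_colP b'; move: (box_col b') => c /andP[+ _].
  by move=> /(leq_ltn_trans (leq0n _)); clear -e2; lia.
have flag b a (aU : a \in U b) := forall_inP (forallP h6 b) a aU.
apply/valid_placementP; split=> // b [i|i] aU.
  have /andP[+ _] := flag b _ aU; change (letter_index _) with i.
  rewrite contentE /key.
  by have := box_colP b; have := box_rowP b; lia.
change (letter_index _) with i.
have [s] := ubnP (part la (box_row b) - box_col b)%N.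
elim: s b i aU => // s IH b i aU lts.
have cP := box_colP b; have rP := box_rowP b.
have [le|lt] := leqP (part la (box_row b)) (box_col b).
  by have /andP[_] := flag b _ aU; rewrite contentE /key; lia.
have [b' rb' cb'] := @box_in_row b (box_col b).+1 ltac:(lia).
have [a' aU'] := set0Pn _ (h1 b').
have [le ne] := row b b' _ _ (esym rb') ltac:(lia) aU aU'.
case: a' aU' le ne => i' aU'; rewrite /key => le ne; first by clear -le; lia.
have ii' : i <> i' by move=> e; have := ne (congr1 _ e).
have {ne}ii' : (i < i')%N.
  by have : i <> i' :> nat by [move/val_inj]; clear -le; lia.
have lts' : (part la (box_row b') - box_col b' < s)%N.
  by rewrite rb' cb'; clear -lts lt; lia.
have := IH b' i' aU' lts'.
by rewrite !contentE rb' cb'; clear -ii' cP; lia.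
Qed.

(** Conversely the lower flag bound on a row is the content bound at its first
    box, whose entries are the smallest ones. *)
Lemma valid_bitableau U : valid U -> is_bitableau U.
Proof.
case/valid_placementP => h1 h2 h3.
have row b b' a a' : (box_row b == box_row b') && (box_col b < box_col b')%N ->
    a \in U b -> a' \in U b' -> earlier (a, content b) (a', content b').
  by move=> rc aU aU'; apply: h3 => //; rewrite precedes_place rc.
have col b b' a a' : (box_col b == box_col b') && (box_row b < box_row b')%N ->
    a \in U b -> a' \in U b' -> earlier (a, content b) (a', content b').
  by move=> rc aU aU'; apply: h3 => //; rewrite precedes_place rc orbT.
have le_key a a' l l' : earlier (a, l) (a', l') -> (key a <= key a')%R.
  by rewrite /earlier /= => /orP[/ltW //|/andP[/eqP -> _]].
apply/and5P; split; last (apply/andP; split).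
- exact/forallP.
- apply/forallP=> b; apply/forallP=> b'; apply/implyP=> rc.
  apply/forall_inP=> a aU; apply/forall_inP => a' aU'.
  exact: le_key (row _ _ _ _ rc aU aU').
- apply/forallP=> b; apply/forallP=> b'; apply/implyP=> rc.
  apply/forall_inP=> a aU; apply/forall_inP => a' aU'.
  exact: le_key (col _ _ _ _ rc aU aU').
- apply/forallP=> b; apply/forallP=> b'; apply/implyP=> rc.
  apply/forallP=> a; apply/implyP => ma; apply/negP => /andP[aU aU'].
  have := col _ _ _ _ rc aU aU'; rewrite /earlier ltxx eqxx.
  rewrite -[(a, content b).1]/a ma orFb andTb.
  change ((content b < content b')%N -> False); rewrite !contentE.
  by have := box_rowP b'; case/andP: rc => /eqP; have := box_colP b; lia.
- apply/forallP=> b; apply/forallP=> b'; apply/implyP=> rc.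
  apply/forallP=> a; apply/implyP => ma; apply/negP => /andP[aU aU'].
  have := row _ _ _ _ rc aU aU'; rewrite /earlier ltxx eqxx.
  rewrite -[(a, content b).1]/a (negbTE ma) orFb andTb.
  change ((content b' < content b)%N -> False); rewrite !contentE.
  by case/andP: rc => /eqP <-; lia.
apply/forallP => b; apply/forall_inP => a aU.
have cP := box_colP b; have rP := box_rowP b.
have := h2 _ _ aU; rewrite contentE; case: a aU => i aU; rewrite /letter_index /key => hi; last first.
  by apply/andP; split; lia.
have [b' rb' cb'] := @box_in_row b (part mu (box_row b)).+1 ltac:(lia).
apply/andP; split; last by lia.
have [a' aU'] := set0Pn _ (h1 b').
have bound : (letter_index a' <= part mu (box_row b) + (m - box_row b))%N.
  by have := h2 _ _ aU'; rewrite contentE rb' cb'; lia.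
have [le|lt] := leqP (box_col b) (part mu (box_row b)).+1.
  by lia.
have rc : (box_row b' == box_row b) && (box_col b' < box_col b)%N.
  by rewrite rb' cb' eqxx.
have := le_key _ _ _ _ (row _ _ _ _ rc aU' aU).
by case: a' {aU'} bound => i'; rewrite /letter_index /key; lia.
Qed.

Lemma valid_bitableauE U : valid U = is_bitableau U.
Proof. by apply/idP/idP => [/valid_bitableau|/bitableau_valid]. Qed.

Lemma sum_bitableaux (R : comNzRingType) (beta : R) (x y : nat -> R) :
  \sum_(V | placement m wmu content_of (@earlier n) (times n) wla V)
    weight m beta wmu (fun p : time => time_weight x y p.1) wla V =
  \sum_(U : filling | is_bitableau U)
    beta ^+ (total_size U - skew_size m la mu) * monomial x y U.
Proof.
rewrite (reindex_onto placement_of filling_of) /=; last first.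
  by move=> V /placementP[cV _ _]; apply: filling_ofK.
apply: eq_big => U; first by rewrite placement_ofK eqxx andbT valid_bitableauE.
by move=> _; rewrite /weight card_placement_of card_boxes prod_placement_of.
Qed.

End Bitableaux.

Lemma included_above (n m : nat) (la mu : seq nat) (wla wmu : 'S_n) :
  included mu la -> grassmannian_of m la wla -> grassmannian_of m mu wmu ->
  above m wmu wla.
Proof.
move=> inc gla gmu x xm.
by rewrite (grassmannian_part gla xm) (grassmannian_part gmu xm) leq_add2r.
Qed.

Theorem theorem1 (m : nat) (hm : (0 < m)%N) (la mu : seq nat)
    (hla : is_partition la) (hmu : is_partition mu)
    (hla_len : (size la <= m)%N) (hmu_len : (size mu <= m)%N)
    (hincl : included mu la)
    (n : nat) (hn : (1 <= n)%N)
    (wla wmu : 'S_n)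
    (hwla : grassmannian_of m la wla) (hwmu : grassmannian_of m mu wmu) :
  grothendieck beta X Y (pmul wla (wmu^-1)%g) =
  \sum_(U : filling n m la mu | is_bitableau U)
     beta ^+ (total_size U - skew_size m la mu) * monomial X Y U.
Proof.
have inc_la := grassmannian_increasing hwla.1.
have inc_mu := grassmannian_increasing hwmu.1.
have ab := included_above hincl hwla hwmu.
rewrite /grothendieck (coef_act beta inc_mu _ inc_la ab) prod_times.
pose content_of (p : letter n * 'I_n.-1) := p.2.
pose t (p : letter n * 'I_n.-1) : groth_ring := time_weight X Y p.1.
have := act_prod_placements beta content_of t (@earlier_irr n) (@earlier_trans n) inc_mu.
move=> /(_ (times n) wla) -> //.
  exact: sum_bitableaux.
exact: times_sorted.
Qed.
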